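(* Let $\rho>0$ and for each $n\ge 1$ let $C^n=\{(\xi_1,\dots,\xi_n)\in\mathbb{R}^n:\ \sum_{1\le l\le n}|\xi_l|\le\rho\}$ be the regular cross-polytope. Then for every $\tau\in\mathbb{C}$, $$\lim_{n\to\infty}\mathscr{M}_{C^n}(\tau)=\sum_{0\le l<\infty}\frac{1}{\Gamma(l+1)}\,\tau^l=\exp\{\tau\}.$$
   Context: A compact convex set $K\subset\mathbb{R}^n$ is called solid if its interior is non-empty, equivalently $\mathrm{Vol}_n(K)>0$. Let $B$ denote the closed unit Euclidean ball of $\mathbb{R}^n$ centered at the origin. By Minkowski, for $t>0$ the function $M_K(t)=\mathrm{Vol}_n(K+tB)$ is a polynomial in $t$ of degree $n$ (the Steiner-Minkowski polynomial of $K$); it is then considered for all complex $t$. Its constant coefficient is $\mathrm{Vol}_n(K)$ and its linear coefficient is the surface area $\mathrm{Vol}_{n-1}(\partial K)$. For solid $K$ the shape factor is $\sigma_K=\mathrm{Vol}_{n-1}(\partial K)/\mathrm{Vol}_n(K)>0$. The renormalized Steiner-Minkowski polynomial $\mathscr{M}_K(\tau)$ is the polynomial in $\tau$ of degree $n$ defined by $M_K(t)=\mathrm{Vol}_n(K)\cdot\mathscr{M}_K(\sigma_K t)$, i.e. $\mathscr{M}_K(\tau)=M_K(\tau/\sigma_K)/\mathrm{Vol}_n(K)$. *)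

(* Defs.v *)
From HB Require Import structures.
From mathcomp Require Import all_boot all_order all_algebra.
From mathcomp Require Import complex.
From mathcomp Require Import all_classical all_reals all_analysis.

Set Implicit Arguments.
Unset Strict Implicit.
Unset Printing Implicit Defensive.

Import Order.TTheory GRing.Theory Num.Theory.
Import numFieldNormedType.Exports.

Local Open Scope classical_set_scope.
Local Open Scope ring_scope.
Local Open Scope complex_scope.

(* Lebesgue measure on R^n as the n-fold product of Lebesgue measure on R: the
   successor case is the formula defining the library's product measure
   [m1 \x m2], with R^(1 + n) split as R * R^n.  For n = 0 it is the Dirac mass
   at the only point.  As with [\x], the value is meaningful on measurable
   sets; for compact K, every set it is applied to below is compact. *)
Fixpoint volume (R : realType) (n : nat) : set 'rV[R]_n -> \bar R :=
  match n return set 'rV[R]_n -> \bar R with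
  | 0 => fun A => (\1_A (0 : 'rV[R]_0))%:E
  | n'.+1 => fun A =>
      (\int[@lebesgue_measure R]_x
         volume [set v : 'rV[R]_n' | A (row_mx x%:M v : 'rV[R]_(1 + n'))])%E
  end.

Definition euclidean_norm (R : realType) (n : nat) (x : 'rV[R]_n) : R :=
  Num.sqrt (\sum_(i < n) x 0 i ^+ 2).

Definition unit_ball (R : realType) (n : nat) : set 'rV[R]_n :=
  [set x | euclidean_norm x <= 1].

(* A + tB, with B the closed Euclidean unit ball *)
Definition parallel_set (R : realType) (n : nat) (A : set 'rV[R]_n) (t : R)
    : set 'rV[R]_n :=
  [set z | exists a b : 'rV[R]_n, [/\ A a, unit_ball b & z = a + t *: b]].

(* The polynomial p with Vol(K + tB) = p(t) for all t > 0.  By Minkowski it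
   exists for every compact convex K, and it is unique since it is prescribed
   at infinitely many points. *)
Definition steiner_poly (R : realType) (n : nat) (K : set 'rV[R]_n) : {poly R} :=
  xget 0 [set p : {poly R} |
    forall t : R, 0 < t -> volume (parallel_set K t) = (p.[t])%:E].

Definition boundary (R : realType) (n : nat) (K : set 'rV[R]_n)
    : set 'rV[R]_n :=
  closure K `\` interior K.

(* (n-1)-dimensional Minkowski content of a subset of R^n.  The denominator
   2t is the length of the one-dimensional ball of radius t. *)
Definition hypersurface_area (R : realType) (n : nat) (S : set 'rV[R]_n) : R :=
  lim (fine (volume (parallel_set S t)) / (2 * t) @[t --> 0^'+]).

Definition shape_factor (R : realType) (n : nat) (K : set 'rV[R]_n) : R :=
  hypersurface_area (boundary K) / fine (volume K).

Definition renormalized_steiner_poly (R : realType) (n : nat)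
    (K : set 'rV[R]_n) : {poly R} :=
  (fine (volume K))^-1 *: (steiner_poly K \Po ((shape_factor K)^-1 *: 'X)).

Definition cross_polytope (R : realType) (rho : R) (n : nat) : set 'rV[R]_n :=
  [set x | \sum_(l < n) `|x 0 l| <= rho].
Arguments cross_polytope {R} rho n _.

Definition Gamma (R : realType) (s : R) : R :=
  \int[@lebesgue_measure R]_(x in `]0, +oo[) (x `^ (s - 1) * expR (- x)).

Definition complex_exp (R : realType) (z : R[i]) : R[i] :=
  let: x +i* y := z in (expR x * cos y) +i* (expR x * sin y).

(* Evaluation of a real polynomial at a complex point.  The type R[i]^o carries
   the topology of C given by the modulus. *)
Definition complex_eval (R : realType) (p : {poly R}) (z : R[i]) : R[i]^o :=
  (map_poly (real_complex R) p).[z].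

(* Main.v *)
Require Import Defs.
From HB Require Import structures.
From mathcomp Require Import all_boot all_order all_algebra.
From mathcomp Require Import complex ring lra.
From mathcomp Require Import all_classical all_reals all_analysis measurable_realfun.

(** Write C for the cross-polytope of radius rho in R^n, B for the unit ball and
    M_n for the renormalized Steiner polynomial of C.

    Steiner formula. Shrinking all coordinates of a point x towards 0 by the
    same threshold l moves x by a squared distance [clip_sq x l] and leaves a
    point of l1-norm [excess x l]. The projection of an outer point onto C has
    this form, so x belongs to C + tB if and only if some l >= 0 satisfies
    excess x l <= rho and clip_sq x l <= t^2 ([parallel_cross_polytopeP]). At a
    fixed threshold both conditions bear on sums over the coordinates, and the
    volume they define splits according to the set of coordinates above l
    ([integral_weight]). The slope of the excess in l is minus the number of
    those coordinates; hence the same volume weighted by this number, once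
    integrated over l, is the integral over the radius of Vol(C + tB) - Vol(C)
    ([distance_threshold], [integral_layers]). It is an explicit polynomial in
    rho, and differentiating it gives Vol(C + tB)
    ([volume_parallel_cross_polytope]), a polynomial in t whose coefficients
    involve the volumes [cap_volume] of pyramids cut by ellipsoids. Together
    with the inner layer of the boundary it gives the shape factor
    n sqrt n / rho ([shape_factor_cross_polytope]).

    Limit. Since B is contained in the cross-polytope of radius sqrt n, the body
    C + tB is contained in C dilated by 1 + t sqrt n / rho, which after
    renormalization reads M_n(T) <= (1 + T / n)^n <= exp T for T >= 0
    ([renormalized_le_expR]). On the other hand the ellipsoids do not cut the
    lower part of the pyramids, and this bounds the coefficient of tau^j in M_n
    from below by (n (n - 1) ... (n - j + 1) / n^j)^2 / j!
    ([renormalized_coef_ge]). The polynomials with these coefficients also tend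
    to the exponential. A polynomial whose coefficients are above theirs and
    whose value at |tau| is at most exp |tau| is therefore close to the
    exponential at tau ([sandwich_exp_sum]). *)

Set Implicit Arguments.
Unset Strict Implicit.
Unset Printing Implicit Defensive.

Import Order.TTheory GRing.Theory Num.Theory.
Import numFieldNormedType.Exports.

Local Open Scope classical_set_scope.
Local Open Scope ring_scope.

(** * Iterated integrals as a product measure *)

Section product_space.
Variable R : realType.
Local Notation leb := (@lebesgue_measure R).

Section line_times.
Variables (d : measure_display) (T : measurableType d).
Variable m : {sigma_finite_measure set T -> \bar R}.

(** The product measure [\x] under a name of its own, so that its
    sigma-finiteness can be recorded and the construction iterated. *)
Definition line_times : set (measurableTypeR R * T) -> \bar R := (leb \x m)%E.

HB.instance Definition _ := Measure.on line_times.

Let line_times_sigma_finite : sigma_finite setT line_times.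
Proof.
have [F TF Foo] := sigma_finiteT leb.
have [G TG Goo] := sigma_finiteT m.
pose box (ij : nat * nat) := F ij.1 `*` G ij.2.
exists (fun n => if unpickle n is Some ij then box ij else set0).
  apply/seteqP; split => // -[x y] _.
  have [i _ Fx] : (\bigcup_i F i) x by rewrite -TF.
  have [j _ Gy] : (\bigcup_j G j) y by rewrite -TG.
  by exists (pickle (i, j)) => //; rewrite pickleK.
move=> n; case: (unpickle n) => [[i j]|]; last by rewrite measure0.
have [mF Fy] := Foo i; have [mG Gy] := Goo j; split; first exact: measurableX.
rewrite /line_times /box product_measure1E//.
by rewrite lte_mul_pinfty// ge0_fin_numE.
Qed.

HB.instance Definition _ := Measure_isSigmaFinite.Build _ _ _ line_times
  line_times_sigma_finite.
End line_times.

(** The measurable structure of R * (R * ...) depends on the number of factors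
    through its display; packing display, type and measure together allows a
    recursion on the dimension. *)
Record mspace := Mspace {
  mdisp : measure_display;
  mcarrier : measurableType mdisp;
  mmeasure : {sigma_finite_measure set mcarrier -> \bar R} }.

Fixpoint space (n : nat) : mspace :=
  match n with
  | 0 => Mspace (@dirac _ unit tt R)
  | n'.+1 => Mspace (line_times (mmeasure (space n')))
  end.

Fixpoint vec (n : nat) : mcarrier (space n) -> 'rV[R]_n :=
  match n return mcarrier (space n) -> 'rV[R]_n with
  | 0 => fun _ => 0
  | n'.+1 => fun p => (row_mx p.1%:M (vec p.2) : 'rV[R]_(1 + n'))
  end.

Local Notation mu n := (mmeasure (space n)).

(** Both sides satisfy the same recursion, for every set A: the product measure
    is defined by integrating the measures of the sections. Theorems on measures
    thus become available for [volume]. *)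
Lemma volumeE n (A : set 'rV[R]_n) : volume A = mu n (@vec n @^-1` A).
Proof.
elim: n A => [A|n IH A] /=.
  by rewrite /dirac !indicE/=; congr ((nat_of_bool _)%:R%:E); rewrite !inE.
rewrite /product_measure1/=; apply: eq_integral => x _.
rewrite IH /=; congr (mu n _); apply/seteqP; split => y /=; by rewrite /xsection/= inE.
Qed.

Lemma sum_vec n (g : R -> R) (p : mcarrier (space n.+1)) :
  \sum_(i < n.+1) g (vec p 0 i) = g p.1 + \sum_(i < n) g (vec p.2 0 i).
Proof.
rewrite big_ord_recl; congr (g _ + _).
  have -> : ord0 = lshift n 0 :> 'I_(1 + n) by exact/val_inj.
  by rewrite [LHS](row_mxEl _ (vec p.2)) mxE eqxx mulr1n.
apply: eq_bigr => i _; congr g.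
have -> : lift ord0 i = rshift 1 i :> 'I_(1 + n) by exact/val_inj.
by rewrite [LHS](row_mxEr p.1%:M).
Qed.
End product_space.

Arguments vec {R n} p.

(** * Shrinking all coordinates by a common threshold *)

Section counting.
Variable R : realType.

(** For l >= 0, the l1-norm of the point obtained from x by moving every
    coordinate towards 0 by l, stopping at 0. *)
Definition excess n (x : 'rV[R]_n) (l : R) : R :=
  \sum_(i < n) Num.max (`|x 0 i| - l) 0.
(** For l >= 0, the squared Euclidean distance by which x moves when its
    coordinates are shrunk by l. *)
Definition clip_sq n (x : 'rV[R]_n) (l : R) : R :=
  \sum_(i < n) Num.min `|x 0 i| l ^+ 2.
(** Number of coordinates that are not annihilated by shrinking by l; this is
    minus the derivative of [excess x] at l. *)
Definition active n (x : 'rV[R]_n) (l : R) : R :=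
  \sum_(i < n) (if l < `|x 0 i| then 1 else 0).

Lemma measurable_sum_vec n d (T : measurableType d) (g : R -> T -> R) :
  measurable_fun [set: measurableTypeR R * T] (fun z => g z.1 z.2) ->
  measurable_fun [set: mcarrier (space R n) * T]
    (fun z => \sum_(i < n) g (vec z.1 0 i) z.2).
Proof.
move=> mg; elim: n => [|n IH].
  by under eq_fun do rewrite big_ord0; exact: measurable_cst.
under eq_fun do rewrite (sum_vec (g ^~ _)).
apply: measurable_funD.
  apply: (measurableT_comp (f := fun z => g z.1 z.2) mg
    (g := fun z : measurableTypeR R * mcarrier (space R n) * T => (z.1.1, z.2))).
  apply: measurable_fun_pair => //=.
  exact: (measurableT_comp measurable_fst measurable_fst).
apply: (measurableT_comp (f := fun z => \sum_(i < n) g (vec z.1 0 i) z.2) IH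
    (g := fun z : measurableTypeR R * mcarrier (space R n) * T => (z.1.2, z.2))).
apply: measurable_fun_pair => //=.
exact: (measurableT_comp measurable_snd measurable_fst).
Qed.

Lemma measurable_excess n : measurable_fun
  [set: mcarrier (space R n) * measurableTypeR R] (fun z => excess (vec z.1) z.2).
Proof.
apply: (@measurable_sum_vec _ _ (measurableTypeR R) (fun y l : R => Num.max (`|y| - l) 0)).
apply: measurable_maxr => //; apply: measurable_funB => //.
by apply: measurableT_comp => //; exact: measurable_fst.
Qed.

Lemma measurable_clip_sq n : measurable_fun
  [set: mcarrier (space R n) * measurableTypeR R] (fun z => clip_sq (vec z.1) z.2).
Proof.
apply: (@measurable_sum_vec _ _ (measurableTypeR R) (fun y l : R => Num.min `|y| l ^+ 2)).
apply: measurable_funX; apply: measurable_minr => //.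
by apply: measurableT_comp => //; exact: measurable_fst.
Qed.

Lemma measurable_active n : measurable_fun
  [set: mcarrier (space R n) * measurableTypeR R] (fun z => active (vec z.1) z.2).
Proof.
apply: (@measurable_sum_vec _ _ (measurableTypeR R) (fun y l : R => if l < `|y| then 1 else 0)).
apply: measurable_fun_ifT => //; apply: measurable_fun_ltr => //.
by apply: measurableT_comp => //; exact: measurable_fst.
Qed.

End counting.

(** * Volumes at a fixed threshold *)

Section counting.
Variable R : realType.
Local Notation leb := (@lebesgue_measure R).

(** Volume of the intersection of the cube [-l, l]^j with the ball of squared
    radius s. *)
Fixpoint cube_ball (j : nat) (l s : R) : \bar R :=
  match j with
  | 0 => ((if 0 <= s then 1 else 0) : R)%:E
  | j'.+1 =>
    (\int[leb]_y (if (`|y| <= l)%R then cube_ball j' l (s - y ^+ 2)%R else 0))%E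
  end.

Lemma cube_ball_ge0 j l s : (0 <= cube_ball j l s)%E.
Proof.
elim: j s => [|j IH] s /=; first by rewrite lee_fin; case: ifP.
by apply: integral_ge0 => y _; case: ifP.
Qed.

Lemma measurable_cube_ball j :
  measurable_fun [set: measurableTypeR R * measurableTypeR R]
    (fun z => cube_ball j z.1 z.2).
Proof.
elim: j => [|j IH] /=.
  apply/measurable_EFinP; apply: measurable_fun_ifT => //.
  exact: measurable_fun_ler.
apply: (measurable_fun_fubini_tonelli_F (m2 := leb)
  (fun w : (measurableTypeR R * measurableTypeR R) * measurableTypeR R =>
     if `|w.2| <= w.1.1 then cube_ball j w.1.1 (w.1.2 - w.2 ^+ 2) else 0%E)).
  apply: measurable_fun_ifT => //.
    apply: measurable_fun_ler; first exact: measurableT_comp.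
    exact: (measurableT_comp measurable_fst).
  apply: (measurableT_comp (f := fun z => cube_ball j z.1 z.2) IH
    (g := fun w : (measurableTypeR R * measurableTypeR R) * measurableTypeR R =>
      (w.1.1, (w.1.2 - w.2 ^+ 2) : measurableTypeR R))).
  apply: measurable_fun_pair => /=; first exact: (measurableT_comp measurable_fst).
  apply: measurable_funB; first exact: (measurableT_comp measurable_snd).
  exact: measurable_funX.
by move=> w; case: ifP => // _; exact: cube_ball_ge0.
Qed.

(** The parameter a makes inductions on the dimension possible: removing a
    coordinate above the threshold raises it by one. *)
Definition weight n (a rho s : R) (x : 'rV[R]_n) (l : R) : R :=
  if (excess x l <= rho) && (clip_sq x l <= s) then a + active x l else 0.

Lemma active_ge0 n (x : 'rV[R]_n) l : 0 <= active x l.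
Proof. by apply: sumr_ge0 => i _; case: ifP. Qed.

Lemma weight_ge0 n a rho s (x : 'rV[R]_n) l : 0 <= a -> 0 <= weight a rho s x l.
Proof. by move=> a0; rewrite /weight; case: ifP => // _; rewrite addr_ge0// active_ge0. Qed.

Lemma measurable_weight n a rho s : measurable_fun
  [set: mcarrier (space R n) * measurableTypeR R]
  (fun z => weight a rho s (vec z.1) z.2).
Proof.
apply: measurable_fun_ifT => //.
  apply: measurable_and; apply: measurable_fun_ler => //.
    exact: measurable_excess.
  exact: measurable_clip_sq.
by apply: measurable_funD => //; exact: measurable_active.
Qed.

(** A first coordinate below the threshold only uses up part of the squared
    distance s. One above it uses up l^2 of s and its own excess of rho, and is
    counted by a. *)
Lemma weight_vecS n a rho s l (p : mcarrier (space R n.+1)) : 0 <= l ->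
  weight a rho s (vec p) l =
  if `|p.1| <= l then weight a rho (s - p.1 ^+ 2) (vec p.2) l
  else weight (a + 1) (rho - (`|p.1| - l)) (s - l ^+ 2) (vec p.2) l.
Proof.
move=> l0; rewrite /weight /excess /clip_sq /active.
rewrite (sum_vec (fun y => Num.max (`|y| - l) 0)).
rewrite (sum_vec (fun y => Num.min `|y| l ^+ 2)).
rewrite (sum_vec (fun y => if l < `|y| then 1 else 0)).
case: leP => yl.
  rewrite max_r ?subr_le0// add0r add0r lerBrDl.
  by rewrite real_normK ?num_real.
by rewrite max_l ?subr_ge0 ?(ltW yl)// !lerBrDl addrA.
Qed.

(** Truncated powers; for k = 0 the value at 0 is 1. Convolution with the half
    line raises k by one, which gives the volumes of simplices. *)
Definition ramp k (rho : R) : R := if 0 <= rho then rho ^+ k / k`!%:R else 0.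

Lemma ramp_ge0 k rho : 0 <= ramp k rho.
Proof. by rewrite /ramp; case: ifP => // r0; rewrite divr_ge0 ?exprn_ge0. Qed.

Lemma measurable_ramp k : measurable_fun [set: measurableTypeR R] (ramp k).
Proof.
apply: measurable_fun_ifT => //; first exact: measurable_fun_ler.
by apply: measurable_funM => //; exact: measurable_funX.
Qed.

End counting.

Section counting.
Variable R : realType.
Local Notation leb := (@lebesgue_measure R).
Local Notation mu n := (mmeasure (space R n)).

Lemma integral_deriv_poly (p : {poly R}) (a b : R) : a <= b ->
  (\int[leb]_(y in `[a, b]) (p^`().[y])%:E = (p.[b] - p.[a])%:E)%E.
Proof.
rewrite le_eqVlt => /predU1P[->|ab].
  by rewrite set_itv1 integral_set1 subrr.
rewrite EFinB; apply: continuous_FTC2 => //.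
- by apply: continuous_subspaceT; exact: continuous_horner.
- split; first by move=> x _; exact: derivable_horner.
  + by apply: cvg_at_right_filter; exact: continuous_horner.
  + by apply: cvg_at_left_filter; exact: continuous_horner.
- by move=> x _; rewrite derivE.
Qed.

Lemma ge0_even_integral (f : R -> \bar R) :
  measurable_fun [set: measurableTypeR R] f -> (forall x, 0 <= f x)%E ->
  (forall x, f (- x) = f x) ->
  (\int[leb]_x f x = 2%:E * \int[leb]_(x in `[0%R, +oo[) f x)%E.
Proof.
move=> mf f0 fN; rewrite -(itv_setU_setT true (0 : R)).
rewrite ge0_integral_setU//=; last 2 first.
- exact: measurable_funTS.
- by apply/disj_setPS => x []/=; rewrite !in_itv/= andbT => /lt_geF ->.
rewrite integral_itv_bndo_bndc; last exact: measurable_funTS.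
rewrite ge0_integration_by_substitution0//.
by rewrite mule_natl mule2n; congr (_ + _)%E; apply: eq_integral => x _; rewrite fN.
Qed.

(** Both half lines beyond l contribute a primitive of the truncated power,
    hence the factor 2. *)
Lemma integral_ramp_tail k (rho l : R) : 0 <= l ->
  (\int[leb]_y ((if `|y| <= l then 0 else ramp k (rho - (`|y| - l)))%:E)
   = (2 * ramp k.+1 rho)%:E)%E.
Proof.
move=> l0; rewrite ge0_even_integral/=; last 3 first.
- apply/measurable_EFinP; apply: measurable_fun_ifT => //.
    exact: measurable_fun_ler.
  apply: measurableT_comp; first exact: measurable_ramp.
  by apply: measurable_funB => //; apply: measurable_funB.
- by move=> x; case: ifP => // _; rewrite lee_fin ramp_ge0.
- by move=> x; rewrite normrN.
rewrite EFinM; congr (_ * _)%E.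
have [rho0|rho0] := leP 0 rho; last first.
  rewrite integral0_eq /ramp ?(lt_geF rho0)// => x _; case: ltP => // lx.
  by rewrite ifF//; apply/negbTE; rewrite -ltNge; lra.
transitivity (\int[leb]_(y in `]l, (rho + l)%R])
    ((rho + l - y) ^+ k / k`!%:R)%:E)%E.
  rewrite integral_mkcond [RHS]integral_mkcond; apply: eq_integral => x _.
  rewrite /patch /ramp !mem_setE !in_itv/= andbT.
  have [x0|x0] := leP 0 x; last by rewrite ifF//; apply/negbTE; lra.
  rewrite ger0_norm//; case: leP => // lx.
  rewrite (_ : (0 <= _) = (x <= rho + l)).
    by case: ifP => //= _; congr ((_ ^+ _ / _)%:E); lra.
  by apply/idP/idP; lra.
rewrite integral_itv_obnd_cbnd; last first.
  apply: measurable_funTS; apply/measurable_EFinP.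
  by apply: measurable_funM => //; apply: measurable_funX; apply: measurable_funB.
pose p : {poly R} := - (k.+1`!%:R)^-1 *: ((rho + l)%:P - 'X) ^+ k.+1.
transitivity (\int[leb]_(y in `[l, (rho + l)%R]) (p^`().[y])%:E)%E.
  apply: eq_integral => y _; congr (_%:E).
  rewrite /p derivZ deriv_exp/= derivB derivC derivX !hornerE hornerMn !hornerE.
  rewrite factS natrM -mulr_natl.
  have : k.+1%:R != 0 :> R by rewrite pnatr_eq0.
  have : k`!%:R != 0 :> R by rewrite pnatr_eq0 -lt0n fact_gt0.
  by move=> u v; field; rewrite u nat1r.
rewrite integral_deriv_poly ?lerDr// /p !hornerE subrr expr0n/= mulr0 sub0r.
by rewrite /ramp rho0 mulNr opprK addrK mulrC.
Qed.

(** Contribution of the points with exactly k coordinates above the threshold l: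
    C(n, k) choices and 2^k signs, excesses in a simplex of volume rho^k / k!,
    the other coordinates in a cube cut by a ball whose squared radius has lost
    k l^2. *)
Definition weight_term n (a rho s l : R) (k : nat) : \bar R :=
  (('C(n, k)%:R * 2 ^+ k * (a + k%:R) * ramp k rho)%:E *
    cube_ball (n - k) l (s - k%:R * l ^+ 2))%E.

Lemma weight_term_ge0 n a rho s l k : 0 <= a -> (0 <= weight_term n a rho s l k)%E.
Proof.
move=> a0; apply: mule_ge0; last exact: cube_ball_ge0.
by rewrite lee_fin !mulr_ge0 ?addr_ge0 ?exprn_ge0 ?ramp_ge0.
Qed.

Lemma measurable_cube_ball_sub j l s : measurable_fun [set: measurableTypeR R]
  (fun y => cube_ball j l (s - y ^+ 2)).
Proof.
apply: (measurableT_comp (f := fun z => cube_ball j z.1 z.2)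
  (@measurable_cube_ball R j) (g := fun y : measurableTypeR R =>
    (l : measurableTypeR R, (s - y ^+ 2) : measurableTypeR R))).
apply: measurable_fun_pair => //.
by apply: measurable_funB => //; exact: measurable_funX.
Qed.

(** The two ways of adding a coordinate, below or above the threshold, feed the
    terms of index k and k + 1 in the next dimension. *)
Lemma integral_weight_term_split n (a rho s l : R) k : 0 <= l -> 0 <= a -> (k <= n)%N ->
  (\int[leb]_y (if (`|y| <= l)%R then weight_term n a rho (s - y ^+ 2) l k
                else weight_term n (a + 1) (rho - (`|y| - l)) (s - l ^+ 2) l k)
   = ('C(n, k)%:R * 2 ^+ k * (a + k%:R) * ramp k rho)%:E *
       cube_ball (n.+1 - k) l (s - k%:R * l ^+ 2) +
     ('C(n, k)%:R * 2 ^+ k.+1 * (a + k.+1%:R) * ramp k.+1 rho)%:E *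
       cube_ball (n - k) l (s - k.+1%:R * l ^+ 2))%E.
Proof.
move=> l0 a0 kn.
pose c1 : R := 'C(n, k)%:R * 2 ^+ k * (a + k%:R) * ramp k rho.
pose c2 : R := 'C(n, k)%:R * 2 ^+ k * (a + k.+1%:R).
have c10 : 0 <= c1 by rewrite !mulr_ge0 ?addr_ge0 ?exprn_ge0 ?ramp_ge0.
have c20 : 0 <= c2 by rewrite !mulr_ge0 ?addr_ge0 ?exprn_ge0.
pose B := cube_ball (n - k) l (s - k.+1%:R * l ^+ 2).
pose u (y : R) := (if (`|y| <= l)%R then
  cube_ball (n - k) l (s - k%:R * l ^+ 2 - y ^+ 2)%R else 0)%E.
pose v (y : R) : \bar R := (if `|y| <= l then 0 else ramp k (rho - (`|y| - l)))%:E.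
have mabs : measurable_fun [set: measurableTypeR R] (fun y : R => `|y| <= l).
  by apply: measurable_fun_ler.
have u0 y : (0 <= u y)%E by rewrite /u; case: ifP => // _; exact: cube_ball_ge0.
have v0 y : (0 <= v y)%E by rewrite /v; case: ifP => // _; rewrite lee_fin ramp_ge0.
have mu_ : measurable_fun [set: measurableTypeR R] u.
  by apply: measurable_fun_ifT => //; exact: measurable_cube_ball_sub.
have mv : measurable_fun [set: measurableTypeR R] v.
  apply/measurable_EFinP; apply: measurable_fun_ifT => //.
  apply: measurableT_comp; first exact: measurable_ramp.
  by apply: measurable_funB => //; apply: measurable_funB.
transitivity (\int[leb]_y (c1%:E * u y + (c2%:E * B) * v y))%E.
  apply: eq_integral => y _; rewrite /u /v; case: ifP => _.
    by rewrite mule0 adde0 /weight_term addrAC.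
  rewrite mule0 add0e /weight_term -addrA nat1r EFinM -!muleA; congr (_ * _)%E.
  by rewrite muleC; congr (cube_ball _ _ _ * _)%E; rewrite -nat1r; ring.
have B0 : (0 <= c2%:E * B)%E by rewrite mule_ge0 ?lee_fin//; exact: cube_ball_ge0.
rewrite ge0_integralD//; last 4 first.
- by move=> y _; rewrite mule_ge0.
- exact: measurable_funeM.
- by move=> y _; rewrite mule_ge0.
- exact: measurable_funeM.
rewrite ge0_integralZl// ge0_integralZl//.
rewrite integral_ramp_tail// subSn//; congr (_ + _)%E.
rewrite muleAC -EFinM; congr (_%:E * _)%E.
by rewrite /c2 exprS; ring.
Qed.

Lemma integral_weight n (a rho s l : R) : 0 <= l -> 0 <= a ->
  (\int[mu n]_x (weight a rho s (vec x) l)%:E =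
   \sum_(k < n.+1) weight_term n a rho s l k)%E.
Proof.
move=> l0; elim: n a rho s => [|n IH] a rho s a0.
  rewrite big_ord1 /weight_term bin0 expr0 mul0r subr0 mul1r addr0 /=.
  rewrite integral_dirac//= diracT mul1e.
  rewrite /weight /excess /clip_sq /active !big_ord0 addr0 /ramp expr0 invr1 mulr1.
  by case: (0 <= rho); case: (0 <= s); rewrite /= -EFinM ?mulr1 ?mulr0 ?mul0r ?mul1r.
transitivity (\int[leb]_y
   \sum_(k < n.+1) (if (`|y| <= l)%R then weight_term n a rho (s - y ^+ 2) l k
     else weight_term n (a + 1) (rho - (`|y| - l)) (s - l ^+ 2) l k))%E.
  rewrite [LHS](@fubini_tonelli1 _ _ _ _ R leb (mu n)); last 2 first.
  - apply/measurable_EFinP.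
    exact: (measurable_fun_pair1 l (@measurable_weight R n.+1 a rho s)).
  - by move=> x; rewrite lee_fin weight_ge0.
  apply: eq_integral => y _; rewrite /fubini_F.
  case yl : (`|y| <= l); rewrite -IH ?addr_ge0//;
    by apply: eq_integral => v _; rewrite weight_vecS//= yl.
rewrite ge0_integral_sum//; last 2 first.
- move=> k; apply: measurable_fun_ifT.
  + by apply: measurable_fun_ler.
  + apply: measurable_funeM; under eq_fun do rewrite addrAC.
    exact: measurable_cube_ball_sub.
  + apply: emeasurable_funM => //; apply/measurable_EFinP.
    apply: measurable_funM => //.
    apply: measurableT_comp; first exact: measurable_ramp.
    by apply: measurable_funB => //; apply: measurable_funB.
- by move=> k y _; case: ifP => _; rewrite weight_term_ge0// addr_ge0.
under eq_bigr => k _ do rewrite integral_weight_term_split// -1?ltnS//.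
pose X k : \bar R := ((2 ^+ k * (a + k%:R) * ramp k rho)%:E *
    cube_ball (n.+1 - k) l (s - k%:R * l ^+ 2))%E.
have X0 k : (0 <= X k)%E.
  apply: mule_ge0; last exact: cube_ball_ge0.
  by rewrite lee_fin !mulr_ge0 ?addr_ge0 ?exprn_ge0 ?ramp_ge0.
transitivity (\sum_(k < n.+1) ('C(n, k)%:R%:E * X k + 'C(n, k)%:R%:E * X k.+1))%E.
  by apply: eq_bigr => k _; rewrite /X !muleA -!EFinM !mulrA subSS.
transitivity (\sum_(k < n.+2) 'C(n.+1, k)%:R%:E * X k)%E; last first.
  by apply: eq_bigr => k _; rewrite /X /weight_term muleA -EFinM !mulrA.
(* Pascal rule; the missing ends of both sums carry a zero binomial. *)
rewrite big_split/= [RHS]big_ord_recl/= bin0.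
under [in RHS]eq_bigr => k _ do
  rewrite /bump/= add1n binS natrD EFinD ge0_muleDl ?lee_fin//.
rewrite [X in _ = (_ + X)%E]big_split/= addeA; congr (_ + _)%E.
rewrite big_ord_recl/= bin0; congr (_ + _)%E.
by rewrite [RHS]big_ord_recr/= bin_small// mul0e adde0.
Qed.

End counting.

(** * Distance to the cross-polytope *)

Section geometry.
Variable R : realType.
Implicit Types (n : nat) (l m r t rho : R).

Lemma excess_ge0 n (x : 'rV[R]_n) l : 0 <= excess x l.
Proof. by apply: sumr_ge0 => i _; rewrite le_max lexx orbT. Qed.

Lemma excess0 n (x : 'rV[R]_n) : excess x 0 = \sum_(i < n) `|x 0 i|.
Proof. by apply: eq_bigr => i _; rewrite subr0 max_l. Qed.

Lemma le_excess n (x : 'rV[R]_n) l m : l <= m -> excess x m <= excess x l.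
Proof.
move=> lm; apply: ler_sum => i _.
by rewrite ge_max !le_max lexx orbT lerB ?lexx.
Qed.

Lemma le_clip_sq n (x : 'rV[R]_n) l m : 0 <= l -> l <= m -> clip_sq x l <= clip_sq x m.
Proof.
move=> l0 lm; apply: ler_sum => i _; rewrite lerXn2r ?nnegrE//.
- by rewrite le_min normr_ge0.
- by rewrite le_min normr_ge0 (le_trans l0 lm).
by rewrite le_min !ge_min lexx/= lm orbT.
Qed.

(** The value [excess x 0] is the l1-norm of x, which bounds every
    coordinate. *)
Lemma excess_large n (x : 'rV[R]_n) : excess x (excess x 0) = 0.
Proof.
rewrite [in LHS]excess0; apply: big1 => i _; apply: max_r.
by rewrite subr_le0 (bigD1 i)//= lerDl sumr_ge0.
Qed.

Lemma continuous_excess n (x : 'rV[R]_n) : continuous (excess x).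
Proof.
apply: continuous_big => [|i _ l]; first exact: add_continuous.
apply: (@continuous_max R R (fun l => `|x 0 i| - l) (fun=> 0)).
  by apply: cvgB; [exact: cvg_cst|exact: cvg_id].
exact: cvg_cst.
Qed.

Lemma continuous_clip_sq n (x : 'rV[R]_n) : continuous (clip_sq x).
Proof.
apply: continuous_big => [|i _ l]; first exact: add_continuous.
apply: (@cvg_comp _ _ _ (fun l => Num.min `|x 0 i| l) (fun y => y ^+ 2)).
  by apply: (@continuous_min R R (fun=> `|x 0 i|) id); [exact: cvg_cst|exact: cvg_id].
exact: exprn_continuous.
Qed.

Lemma excess_ivt n (x : 'rV[R]_n) rho m : 0 <= m -> excess x m <= rho <= excess x 0 ->
  exists2 l, 0 <= l <= m & excess x l = rho.
Proof.
move=> m0 /andP[mr r0].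
have [||l] := @IVT R (excess x) 0 m rho m0.
- by apply: continuous_subspaceT; exact: continuous_excess.
- by rewrite ge_min mr orbT le_max r0.
- by rewrite in_itv /= => lm <-; exists l.
Qed.

Lemma parallel_setP n (A : set 'rV[R]_n) t (x : 'rV[R]_n) : 0 < t ->
  parallel_set A t x <-> exists2 a, A a & \sum_(i < n) (x 0 i - a 0 i) ^+ 2 <= t ^+ 2.
Proof.
have unitE (b : 'rV[R]_n) : unit_ball b <-> \sum_(i < n) b 0 i ^+ 2 <= 1.
  by rewrite /unit_ball/= /euclidean_norm -[X in _ <= X]sqrtr1 ler_sqrt.
move=> t0; split.
  move=> [a [b [Aa /unitE b1 ->]]]; exists a => //.
  rewrite (eq_bigr (fun i => t ^+ 2 * b 0 i ^+ 2)); last first.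
    by move=> i _; rewrite !mxE; ring.
  by rewrite -mulr_sumr ler_piMr ?sqr_ge0.
move=> [a Aa xa]; exists a, (t^-1 *: (x - a)); split=> //.
  apply/unitE; rewrite (eq_bigr (fun i => (t ^+ 2)^-1 * (x 0 i - a 0 i) ^+ 2)).
    by rewrite -mulr_sumr mulrC ler_pdivrMr ?mul1r// exprn_gt0.
  by move=> i _; rewrite !mxE exprMn exprVn.
by rewrite scalerA divff ?gt_eqF// scale1r addrC subrK.
Qed.

Definition soft l (y : R) : R :=
  if l < y then y - l else if y < - l then y + l else 0.

Lemma norm_soft l y : 0 <= l -> `|soft l y| = Num.max (`|y| - l) 0.
Proof.
move=> l0; rewrite /soft; case: ltP => [ly|yl].
  by rewrite !ger0_norm ?max_l; lra.
case: ltP => yNl; first by rewrite !ler0_norm ?max_l; lra.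
by rewrite normr0 max_r// subr_le0 ler_norml yl yNl.
Qed.

Lemma sub_soft l y : 0 <= l -> (y - soft l y) ^+ 2 = Num.min `|y| l ^+ 2.
Proof.
move=> l0; rewrite /soft; case: ltP => [ly|yl].
  by rewrite ger0_norm ?min_r; [congr (_ ^+ 2)| | ]; lra.
case: ltP => yNl; first by rewrite ler0_norm ?min_r; [rewrite -sqrrN; congr (_ ^+ 2)| | ]; lra.
by rewrite subr0 min_l ?real_normK ?num_real// ler_norml yl yNl.
Qed.

(** The minimum over z of (y - z)^2 + 2 l |z| is attained at [soft l y]. This is
    the one-dimensional fact behind the projection onto an l1-ball, with l as
    Lagrange multiplier. *)
Lemma soft_optimal l y z : 0 <= l ->
  Num.min `|y| l ^+ 2 + 2 * l * Num.max (`|y| - l) 0 <= (y - z) ^+ 2 + 2 * l * `|z|.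
Proof.
move=> l0.
have h (a c : R) : 0 <= a -> 0 <= c ->
    Num.min a l ^+ 2 + 2 * l * Num.max (a - l) 0 <= (a - c) ^+ 2 + 2 * l * c.
  move=> a0 c0; have [al|la] := leP a l.
    by rewrite max_r ?subr_le0//; nra.
  rewrite max_l ?subr_ge0 ?(ltW la)//.
  have := sqr_ge0 (a - c - l); nra.
apply: le_trans (h _ _ (normr_ge0 y) (normr_ge0 z)) _.
rewrite lerD2r -[leLHS]real_normK ?num_real// -[leRHS]real_normK ?num_real//.
by rewrite lerXn2r ?nnegrE ?normr_ge0//; exact: ler_dist_dist.
Qed.

(** The nearest point of the polytope to an outer point x is obtained by
    shrinking x until its l1-norm is rho; summing [soft_optimal] over the
    coordinates shows that no other point is closer. *)
Lemma parallel_cross_polytopeP n rho t (x : 'rV[R]_n) : 0 <= rho -> 0 < t ->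
  parallel_set (cross_polytope rho n) t x <->
  exists l, [/\ 0 <= l, excess x l <= rho & clip_sq x l <= t ^+ 2].
Proof.
move=> r0 t0; rewrite parallel_setP//; split; last first.
  move=> [l [l0 xr xt]]; exists (\row_i soft l (x 0 i)).
    rewrite /cross_polytope/=; apply: le_trans xr; apply: ler_sum => i _.
    by rewrite mxE norm_soft.
  apply: le_trans xt; apply: ler_sum => i _.
  by rewrite mxE sub_soft.
move=> [a]; rewrite /cross_polytope/= => ar xa.
have [xr|xr] := leP (excess x 0) rho.
  exists 0; split => //; rewrite [leLHS]big1 ?sqr_ge0// => i _.
  by rewrite min_r// expr0n.
have [|l /andP[l0 _] lr] := @excess_ivt _ x rho _ (excess_ge0 x 0).
  by rewrite excess_large r0 ltW.
exists l; split => //; first by rewrite lr.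
(* Compare x with an arbitrary point a of the polytope, at the threshold l
   where the shrunk point reaches the boundary. *)
have : clip_sq x l + 2 * l * excess x l <=
    \sum_(i < n) (x 0 i - a 0 i) ^+ 2 + 2 * l * \sum_(i < n) `|a 0 i|.
  rewrite /clip_sq /excess !mulr_sumr -!big_split/=; apply: ler_sum => i _.
  exact: soft_optimal.
rewrite lr => H; have : 2 * l * \sum_(i < n) `|a 0 i| <= 2 * l * rho.
  by rewrite ler_wpM2l ?mulr_ge0.
by move: H xa; lra.
Qed.

End geometry.

(** * Integrating over the threshold *)

Section layers.
Variable R : realType.
Local Notation leb := (@lebesgue_measure R).
Implicit Types (n : nat) (l m r t rho s : R).

Lemma excess_eq0 n (x : 'rV[R]_n) m : excess x m = 0 -> forall i, `|x 0 i| <= m.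
Proof.
move=> /psumr_eq0P H i; rewrite -subr_le0 -(H _ i isT) ?le_max ?lexx// => j _.
by rewrite le_max lexx orbT.
Qed.

Lemma active_eq0 n (x : 'rV[R]_n) l : (forall i, `|x 0 i| <= l) -> active x l = 0.
Proof. by move=> xl; apply: big1 => i _; rewrite ltNge xl. Qed.

Lemma lt_excess n (x : 'rV[R]_n) l m : l < m -> 0 < excess x m -> excess x m < excess x l.
Proof.
move=> lm xm; rewrite lt_neqAle le_excess ?(ltW lm)// andbT; apply/eqP => E.
have h (a : R) : 0 <= Num.max (a - l) 0 - Num.max (a - m) 0 ?= iff (a <= l).
  apply/leifP; case: (leP a l) => al; first by rewrite !max_r; lra.
  by rewrite (max_l (_ : 0 <= a - l)); [case: (leP (a - m) 0)| ]; lra.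
have /psumr_eq0P H : \sum_(i < n)
    (Num.max (`|x 0 i| - l) 0 - Num.max (`|x 0 i| - m) 0) = 0.
  by rewrite sumrB -/(excess x l) -/(excess x m) E subrr.
suff x0 : excess x m = 0 by rewrite x0 ltxx in xm.
apply: big1 => i _; apply: max_r; rewrite subr_le0; apply: le_trans (ltW lm).
by rewrite -(h _) H ?eqxx// => j _; exact: h.
Qed.

Lemma integral_lt_itv (a b c : R) : a <= b ->
  (\int[leb]_(l in `[a, b]) (if (l < c)%R then 1 else 0)%:E
   = (Num.max (c - a) 0 - Num.max (c - b) 0)%:E)%E.
Proof.
move=> ab; transitivity (\int[leb]_(l in `[a, b]) (\1_`]-oo, c[ l)%:E)%E.
  by apply: eq_integral => l _; rewrite indicE mem_setE in_itv/=; case: ltP.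
rewrite integral_indic//=.
have [ca|ac] := leP c a.
  rewrite (_ : _ `&` _ = set0) ?measure0.
    by rewrite !max_r ?subrr//; lra.
  by apply/seteqP; split => // l/=; rewrite !in_itv/=; lra.
have [cb|bc] := leP c b.
  rewrite (_ : _ `&` _ = `[a, c[%classic).
    by rewrite lebesgue_measure_itv/= lte_fin ac max_l ?max_r ?subr0//; lra.
  by apply/seteqP; split => l/=; rewrite !in_itv/=; lra.
rewrite (_ : _ `&` _ = `[a, b]%classic).
  rewrite lebesgue_measure_itv/= lte_fin; case: ltP => ab'.
    by rewrite !max_l; [congr (_%:E); lra| |]; lra.
  by rewrite !max_l; [congr (_%:E); lra| |]; lra.
by apply/seteqP; split => l/=; rewrite !in_itv/=; lra.
Qed.

(** The fundamental theorem of calculus for the piecewise linear function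
    [excess x]. *)
Lemma integral_active n (x : 'rV[R]_n) (a b : R) : a <= b ->
  (\int[leb]_(l in `[a, b]) (active x l)%:E = (excess x a - excess x b)%:E)%E.
Proof.
move=> ab; rewrite /excess -sumrB -sumEFin.
rewrite (eq_bigr _ (fun i _ => esym (integral_lt_itv `|x 0 i| ab))).
rewrite -ge0_integral_sum//.
- by apply: eq_integral => l _; rewrite /active -sumEFin.
- move=> i; apply: measurable_funTS; apply/measurable_EFinP.
  by apply: measurable_fun_ifT => //; exact: measurable_fun_ltr.
- by move=> i l _; rewrite lee_fin; case: ifP.
Qed.

(** The largest relevant threshold m at squared distance s. The distance can
    stay at most s beyond m only after x has been shrunk to 0. *)
Lemma clip_threshold n (x : 'rV[R]_n) s : 0 <= s -> exists m, [/\ 0 <= m,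
  clip_sq x m <= s & forall l, m < l -> clip_sq x l <= s -> excess x m = 0].
Proof.
move=> s0; have [xs|xs] := leP (clip_sq x (excess x 0)) s.
  by exists (excess x 0); split => // *; rewrite ?excess_ge0 ?excess_large.
have c0 : clip_sq x 0 = 0 by apply: big1 => i _; rewrite min_r// expr0n.
have [||m] := @IVT R (clip_sq x) 0 (excess x 0) s (excess_ge0 x 0).
- by apply: continuous_subspaceT; exact: continuous_clip_sq.
- by rewrite c0 ge_min s0/= le_max (ltW xs) orbT.
rewrite in_itv/= => /andP[m0 _] ms; exists m; split; rewrite ?ms// => l ml.
rewrite -ms => xl; have : \sum_(i < n)
    (Num.min `|x 0 i| l ^+ 2 - Num.min `|x 0 i| m ^+ 2) = 0.
  apply/eqP; rewrite sumrB subr_eq0 eq_le; apply/andP; split => //.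
  by apply: le_clip_sq => //; exact: ltW.
have h (a : R) : 0 <= a -> 0 <= Num.min a l ^+ 2 - Num.min a m ^+ 2 ?= iff (a <= m).
  move=> a0; apply/leifP; case: (leP a m) => am.
    by rewrite min_l ?subrr// (le_trans am)// ltW.
  by case: (leP a l) => al; nra.
move=> /psumr_eq0P E; apply: big1 => i _; apply: max_r; rewrite subr_le0.
by rewrite -(h _ (normr_ge0 _)) E ?eqxx// => j _; exact: h.
Qed.

(** The integrand is minus the derivative of the excess restricted to the
    thresholds where the excess is at most rho, so the integral is a difference
    of two truncations. *)
Lemma integral_active_excess_le n (x : 'rV[R]_n) rho m : 0 <= m -> 0 < rho ->
  (\int[leb]_(l in `[0%R, m]) (if (excess x l <= rho)%R then active x l else 0%R)%:E
   = (Num.max (rho - excess x m) 0 - Num.max (rho - excess x 0) 0)%:E)%E.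
Proof.
move=> m0 r0; have xm0 := le_excess x m0.
have [rm|mr] := ltP rho (excess x m).
  rewrite integral0_eq; first by rewrite !max_r ?subrr//; lra.
  move=> l/=; rewrite in_itv/= => /andP[l0 lm].
  by rewrite leNgt (lt_le_trans rm)//; exact: le_excess.
have [m1 /andP[m10 m1m] m1E] :
    exists2 m1, 0 <= m1 <= m & excess x m1 = Num.min rho (excess x 0).
  by apply: excess_ivt => //; rewrite le_min mr xm0 ge_min lexx orbT.
(* m1 is where the constraint excess <= rho becomes true; below m1 it fails,
   or no coordinate is left above the threshold. *)
transitivity (\int[leb]_(l in `[m1, m]) (active x l)%:E)%E; last first.
  rewrite integral_active// m1E; congr (_%:E); rewrite max_l ?subr_ge0//.
  by case: (leP rho (excess x 0)) => h; [rewrite max_r|rewrite max_l]; lra.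
rewrite integral_mkcond [RHS]integral_mkcond; apply: eq_integral => l _.
rewrite /patch !mem_setE !in_itv/=; have [lm|lm] := leP l m; last by rewrite !andbF.
rewrite !andbT; have [m1l|lm1] := leP m1 l.
  rewrite (le_trans m10 m1l) ifT//; apply: le_trans (le_excess x m1l) _.
  by rewrite m1E ge_min lexx.
case: (leP 0 l) => // l0; case: (leP _ rho) => // xl.
rewrite active_eq0//; apply: excess_eq0; apply/eqP.
rewrite eq_le excess_ge0 andbT leNgt; apply/negP => pos.
have : excess x m1 <= excess x l := le_excess x (ltW lm1).
have [/(lt_excess lm1)|] := ltP 0 (excess x m1); last first.
  by rewrite m1E ge_min => /orP[|]; have := le_excess x l0; lra.
by rewrite m1E; have := le_excess x l0; case: (leP rho (excess x 0)); lra.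
Qed.

(** For fixed distance, phi is the smallest radius of a polytope whose parallel
    body contains x. The last clause writes the length of the part below rho of
    the interval between phi and the l1-norm of x as an integral over thresholds
    of weights that depend on x through sums over its coordinates, which is what
    makes the volume computable. *)
Lemma distance_threshold n (x : 'rV[R]_n) s : 0 <= s -> exists phi : R,
  [/\ phi <= excess x 0,
      forall rho, 0 <= rho -> phi <= rho <->
        (exists l, [/\ 0 <= l, excess x l <= rho & clip_sq x l <= s])
    & forall rho, 0 < rho ->
        (\int[leb]_(l in `[0%R, +oo[) (weight 0 rho s x l)%:E
         = (Num.max (rho - phi) 0 - Num.max (rho - excess x 0) 0)%:E)%E].
Proof.
move=> s0; have [m [m0 xm mP]] := clip_threshold x s0.
exists (excess x m); split; first exact: le_excess.
  move=> rho r0; split => [xr|[l [l0 xr xs]]]; first by exists m.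
  have [lm|ml] := leP l m; last by rewrite (mP l).
  by apply: le_trans xr; exact: le_excess.
move=> rho r0; rewrite -integral_active_excess_le//.
rewrite integral_mkcond [RHS]integral_mkcond; apply: eq_integral => l _.
rewrite /patch !mem_setE !in_itv/= andbT; case: (leP 0 l) => //= l0.
rewrite /weight add0r; have [lm|ml] := leP l m.
  by rewrite (le_trans (le_clip_sq x l0 lm) xm) andbT.
case: ifP => // /andP[xr xs]; rewrite active_eq0// => i.
by apply: le_trans (ltW ml); apply: excess_eq0; exact: mP xs.
Qed.

End layers.

(** * Cubes cut by balls *)

Section caps.
Variable R : realType.
Local Notation leb := (@lebesgue_measure R).

Lemma cube_ball_lt0 j (l s : R) : s < 0 -> cube_ball j l s = 0%E.
Proof.
elim: j s => [|j IH] s s0 /=; first by rewrite leNgt s0.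
rewrite integral0_eq// => y _; case: ifP => // _.
by rewrite IH// (le_lt_trans _ s0)// gerBl sqr_ge0.
Qed.

Lemma integral_abs_le (l c : R) : 0 <= l -> 0 <= c ->
  (\int[leb]_y (if (`|y| <= l)%R then c else 0%R)%:E = (2 * l * c)%:E)%E.
Proof.
move=> l0 c0; transitivity (\int[leb]_(y in `[(- l)%R, l]) c%:E)%E.
  rewrite [RHS]integral_mkcond; apply: eq_integral => y _.
  by rewrite /patch mem_setE in_itv/= ler_norml; case: ifP.
rewrite integral_cst//= lebesgue_measure_itv/= lte_fin.
case: ltP => h; first by rewrite -EFinB -EFinM; congr (_%:E); ring.
have -> : l = 0 by lra.
by rewrite mule0 mulr0 mul0r.
Qed.

Lemma measurable_cube_ball_slice j (l s : R) : measurable_fun [set: measurableTypeR R]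
  (fun y => if (`|y| <= l)%R then cube_ball j l (s - y ^+ 2)%R else 0%E).
Proof.
apply: measurable_fun_ifT => //; last exact: measurable_cube_ball_sub.
exact: measurable_fun_ler.
Qed.

Lemma cube_ball_le j (l s : R) : 0 <= l -> (cube_ball j l s <= ((2 * l) ^+ j)%:E)%E.
Proof.
move=> l0; elim: j s => [|j IH] s /=; first by rewrite lee_fin; case: ifP.
rewrite exprS -integral_abs_le// ?exprn_ge0 ?mulr_ge0//.
apply: ge0_le_integral => //.
- by move=> y _; case: ifP => // _; exact: cube_ball_ge0.
- exact: measurable_cube_ball_slice.
- apply/measurable_EFinP; apply: measurable_fun_ifT => //.
  exact: measurable_fun_ler.
- by move=> y _; case: ifP.
Qed.

Lemma cube_ball_full j (l s : R) : 0 <= l -> j%:R * l ^+ 2 <= s ->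
  cube_ball j l s = ((2 * l) ^+ j)%:E.
Proof.
move=> l0; elim: j s => [|j IH] s /=; first by rewrite mul0r => ->.
move=> js; rewrite exprS -integral_abs_le// ?exprn_ge0 ?mulr_ge0//.
apply: eq_integral => y _; case: ifP => // yl; apply: IH.
have : y ^+ 2 <= l ^+ 2 by rewrite -real_normK ?num_real// lerXn2r ?nnegrE.
by move: js; rewrite -nat1r; lra.
Qed.

(** Volume of the region of R^(j + 1) made of the points (l, z) with |z_i| <= l
    and k l^2 + |z|^2 <= s. *)
Definition cap j k (s : R) : \bar R :=
  (\int[leb]_(l in `[0%R, +oo[) cube_ball j l (s - k%:R * l ^+ 2)%R)%E.

Lemma cap_ge0 j k s : (0 <= cap j k s)%E.
Proof. by apply: integral_ge0 => l _; exact: cube_ball_ge0. Qed.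

Lemma measurable_cap_fun j k (s : R) : measurable_fun [set: measurableTypeR R]
  (fun l => cube_ball j l (s - k%:R * l ^+ 2)).
Proof.
apply: (measurableT_comp (f := fun z => cube_ball j z.1 z.2)
  (@measurable_cube_ball R j) (g := fun l : measurableTypeR R =>
    (l, (s - k%:R * l ^+ 2) : measurableTypeR R))).
apply: measurable_fun_pair => //; apply: measurable_funB => //.
by apply: measurable_funM => //; exact: measurable_funX.
Qed.

Lemma integral_cube_volume j (b : R) : 0 <= b ->
  (\int[leb]_(l in `[0%R, b]) ((2 * l) ^+ j)%:E
   = (2 ^+ j * b ^+ j.+1 / j.+1%:R)%:E)%E.
Proof.
move=> b0; pose p : {poly R} := (2 ^+ j / j.+1%:R) *: 'X^(j.+1).
transitivity (\int[leb]_(l in `[0%R, b]) (p^`().[l])%:E)%E.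
  apply: eq_integral => l _; congr (_%:E).
  rewrite /p derivZ derivXn !hornerE hornerMn !hornerE exprMn -(mulr_natr _ j.+1)/=.
  have n0 : j.+1%:R != 0 :> R by rewrite pnatr_eq0.
  by field; rewrite nat1r.
rewrite integral_deriv_poly// /p !hornerE expr0n/= mulr0 subr0; congr (_%:E).
by rewrite -!mulrA; congr (_ * _); rewrite mulrC.
Qed.

Lemma measurable_cube_volume j (D : set (measurableTypeR R)) :
  measurable_fun D (fun l : R => ((2 * l) ^+ j)%:E).
Proof.
apply: measurable_funTS; apply/measurable_EFinP; apply: measurable_funX.
by apply: measurable_funM.
Qed.

(** The region is contained in the pyramid cut at the largest threshold l
    compatible with k l^2 <= t^2. *)
Lemma cap_le j k (t : R) : 0 <= t -> (0 < k)%N ->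
  (cap j k (t ^+ 2) <= (2 ^+ j * (t / Num.sqrt k%:R) ^+ j.+1 / j.+1%:R)%:E)%E.
Proof.
move=> t0 k0; have sk : 0 < Num.sqrt k%:R :> R by rewrite sqrtr_gt0 ltr0n.
rewrite -integral_cube_volume ?divr_ge0 ?sqrtr_ge0//.
rewrite /cap integral_mkcond [leRHS]integral_mkcond.
apply: ge0_le_integral => //.
- by move=> l _; apply: erestrict_ge0 => y _; exact: cube_ball_ge0.
- by apply/(measurable_restrictT _ _).1 => //; apply: measurable_funTS; exact: measurable_cap_fun.
- by apply/(measurable_restrictT _ _).1 => //; exact: measurable_cube_volume.
move=> l _; rewrite /patch !mem_setE !in_itv/= andbT.
case: (leP 0 l) => //= l0; case: (leP l (t / Num.sqrt k%:R)) => lt; first exact: cube_ball_le.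
rewrite cube_ball_lt0// subr_lt0.
rewrite -[k%:R]sqr_sqrtr// -exprMn ltrXn2r ?nnegrE ?mulr_ge0 ?sqrtr_ge0//.
by rewrite mulrC -ltr_pdivrMr.
Qed.

(** Up to l = t / sqrt (j + k) the ball does not cut the cube. In the
    application j + k is the dimension of the space, so that this height is the
    same for all j. *)
Lemma cap_ge j k (t : R) : 0 <= t -> (0 < k)%N ->
  ((2 ^+ j * (t / Num.sqrt (j + k)%:R) ^+ j.+1 / j.+1%:R)%:E <= cap j k (t ^+ 2))%E.
Proof.
move=> t0 k0.
have sk : 0 < Num.sqrt (j + k)%:R :> R by rewrite sqrtr_gt0 ltr0n addn_gt0 k0 orbT.
rewrite -integral_cube_volume ?divr_ge0 ?sqrtr_ge0//.
rewrite /cap integral_mkcond [leRHS]integral_mkcond.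
apply: ge0_le_integral => //.
- move=> l _; apply: erestrict_ge0 => y /=; rewrite in_itv/= => /andP[y0 _].
  by rewrite lee_fin exprn_ge0// mulr_ge0.
- by apply/(measurable_restrictT _ _).1 => //; exact: measurable_cube_volume.
- by apply/(measurable_restrictT _ _).1 => //; apply: measurable_funTS; exact: measurable_cap_fun.
move=> l _; rewrite /patch !mem_setE !in_itv/= andbT.
case: (leP 0 l) => //= l0; case: (leP l (t / Num.sqrt (j + k)%:R)) => lt; last exact: cube_ball_ge0.
rewrite cube_ball_full// lerBrDl -mulrDl -natrD addnC.
rewrite -[X in X * _]sqr_sqrtr// -exprMn lerXn2r ?nnegrE ?mulr_ge0 ?sqrtr_ge0//.
by rewrite mulrC -ler_pdivlMr.
Qed.

End caps.

Section scaling.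
Variable R : realType.
Local Notation leb := (@lebesgue_measure R).
(** By uniqueness of Lebesgue measure: a times its image under the dilation of
    ratio a gives each interval its length. *)
Lemma ge0_integral_scale (a : R) (f : R -> \bar R) : 0 < a ->
  measurable_fun [set: measurableTypeR R] f -> (forall y, 0 <= f y)%E ->
  (\int[leb]_y f y = a%:E * \int[leb]_y f (a * y)%R)%E.
Proof.
move=> a0 mf f0.
pose g : measurableTypeR R -> measurableTypeR R := *%R a.
have mg : measurable_fun [set: measurableTypeR R] g by exact: mulrl_measurable.
pose m : {measure set (measurableTypeR R) -> \bar R} :=
  mscale (NngNum (ltW a0))
    (measure_function_pushforward__canonical__measure_function_Measure leb mg).
transitivity (\int[m]_y f y)%E.
  apply: eq_measure_integral => A mA _.
  apply: (@lebesgue_measure_unique R m) => //.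
  move=> _ [[u v]] _ <-.
  rewrite [RHS](_ : _ = a%:E * leb (g @^-1` `]u, v]))%E//.
  rewrite (_ : g @^-1` _ = `]a^-1 * u, a^-1 * v]%classic).
    rewrite !lebesgue_measure_itv/= !lte_fin ltr_pM2l ?invr_gt0//.
    case: ifP => _; last by rewrite mule0.
    by rewrite -!EFinB -EFinM -mulrBr mulVKf ?gt_eqF.
  apply/seteqP; split => y/=; rewrite /g !in_itv/=.
    by rewrite ltr_pdivrMl// ler_pdivlMl.
  by rewrite ltr_pdivrMl// ler_pdivlMl.
rewrite ge0_integral_mscale//=.
by rewrite ge0_integral_pushforward.
Qed.
End scaling.

Section caps.
Variable R : realType.
Local Notation leb := (@lebesgue_measure R).
Local Notation mu n := (mmeasure (space R n)).

Lemma cube_ball_scale j (a l s : R) : 0 < a ->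
  cube_ball j (a * l) (a ^+ 2 * s) = ((a ^+ j)%:E * cube_ball j l s)%E.
Proof.
move=> a0; elim: j s => [|j IH] s /=.
  by rewrite pmulr_rge0 ?exprn_gt0// expr0 mul1e.
rewrite (ge0_integral_scale a0); last 2 first.
- exact: measurable_cube_ball_slice.
- by move=> y; case: ifP => // _; exact: cube_ball_ge0.
rewrite (exprS a j) EFinM -muleA; congr (_ * _)%E.
rewrite -ge0_integralZl//; last 3 first.
- exact: measurable_cube_ball_slice.
- by move=> y _; case: ifP => // _; exact: cube_ball_ge0.
- by rewrite lee_fin exprn_ge0// ltW.
apply: eq_integral => y _.
rewrite normrM (gtr0_norm a0) ler_pM2l//; case: ifP => _; last by rewrite mule0.
by rewrite -IH; congr cube_ball; ring.
Qed.

Lemma cap_scale j k (a s : R) : 0 < a ->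
  cap j k (a ^+ 2 * s) = ((a ^+ j.+1)%:E * cap j k s)%E.
Proof.
move=> a0; rewrite /cap integral_mkcond (ge0_integral_scale a0); last 2 first.
- apply/(measurable_restrictT _ _).1 => //.
  by apply: measurable_funTS; exact: measurable_cap_fun.
- by move=> y; apply: erestrict_ge0 => l _; exact: cube_ball_ge0.
rewrite (exprS a j) EFinM -muleA; congr (_ * _)%E.
rewrite [in RHS]integral_mkcond -ge0_integralZl//; last 3 first.
- apply/(measurable_restrictT _ _).1 => //.
  by apply: measurable_funTS; exact: measurable_cap_fun.
- by move=> y _; apply: erestrict_ge0 => l _; exact: cube_ball_ge0.
- by rewrite lee_fin exprn_ge0// ltW.
apply: eq_integral => l _.
rewrite /patch !mem_setE !in_itv/= !andbT pmulr_rge0//.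
case: ifP => _; last by rewrite mule0.
by rewrite -cube_ball_scale//; congr cube_ball; ring.
Qed.

Definition cap_volume j k : R := fine (cap j k 1).

Lemma cap_volumeE j k : (0 < k)%N -> (cap_volume j k)%:E = cap j k 1.
Proof.
move=> k0; rewrite fineK// ge0_fin_numE ?cap_ge0//.
have := cap_le j (@ler01 R) k0; rewrite expr1n => /le_lt_trans; apply.
exact: ltry.
Qed.

Lemma cap_volume_ge j k : (0 < k)%N ->
  2 ^+ j * (Num.sqrt (j + k)%:R)^-1 ^+ j.+1 / j.+1%:R <= cap_volume j k.
Proof.
move=> k0; rewrite -lee_fin cap_volumeE//.
by have := cap_ge j (@ler01 R) k0; rewrite expr1n div1r.
Qed.

(** For j = 0 the upper and lower bounds coincide. This case gives the surface
    area. *)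
Lemma cap_volume0 k : (0 < k)%N -> cap_volume 0 k = (Num.sqrt k%:R)^-1.
Proof.
move=> k0; apply/eqP; rewrite eq_le; apply/andP; split.
  rewrite -lee_fin cap_volumeE//.
  by have := cap_le 0 (@ler01 R) k0; rewrite expr1n div1r expr0 mul1r divr1.
by have := cap_volume_ge 0 k0; rewrite expr0 mul1r divr1.
Qed.

Lemma capE j k (t : R) : 0 < t -> (0 < k)%N ->
  cap j k (t ^+ 2) = (t ^+ j.+1 * cap_volume j k)%:E.
Proof. by move=> t0 k0; rewrite EFinM cap_volumeE// -cap_scale// mulr1. Qed.

Lemma measurable_layers n (rho s : R) : measurable_fun
  [set: mcarrier (space R n) * measurableTypeR R]
  (fun z => ((fun l : R => (weight 0 rho s (vec z.1) l)%:E) \_ `[0%R, +oo[ ) z.2).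
Proof.
rewrite (_ : (fun z => _) = fun z => (if 0 <= z.2 then weight 0 rho s (vec z.1) z.2 else 0)%:E).
  apply/measurable_EFinP; apply: measurable_fun_ifT => //.
    exact: measurable_fun_ler.
  exact: measurable_weight.
by apply/funext => z; rewrite /patch mem_setE in_itv/= andbT; case: ifP.
Qed.

Lemma layers_ge0 n (rho s : R) (z : mcarrier (space R n) * R) :
  (0 <= ((fun l : R => (weight 0%R rho s (vec z.1) l)%:E) \_ `[0%R, +oo[ ) z.2)%E.
Proof. by apply: erestrict_ge0 => l _; rewrite lee_fin weight_ge0. Qed.

(** Exchanging the integrals over x and over the threshold leaves, at each
    threshold, the volumes of [integral_weight]. The term k = 0 vanishes because
    of its weight, although the corresponding cap is infinite. *)
Lemma integral_layers n (rho t : R) : 0 < t ->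
  (\int[mu n]_x \int[leb]_(l in `[0%R, +oo[) (weight 0 rho (t ^+ 2) (vec x) l)%:E =
   (\sum_(k < n.+1) 'C(n, k)%:R * 2 ^+ k * k%:R * ramp k rho *
     (t ^+ (n - k).+1 * cap_volume (n - k) k))%:E)%E.
Proof.
move=> t0; under eq_integral do rewrite integral_mkcond.
rewrite (fubini_tonelli _ (@measurable_layers n rho _) (layers_ge0 rho _)).
transitivity (\int[leb]_(l in `[0%R, +oo[)
    \sum_(k < n.+1) weight_term n 0 rho (t ^+ 2) l k)%E.
  rewrite [RHS]integral_mkcond; apply: eq_integral => l _.
  rewrite /patch mem_setE in_itv/= andbT; case: ifP => l0; first by rewrite integral_weight.
  by rewrite integral0.
rewrite ge0_integral_sum//; last 2 first.
- move=> k; apply: measurable_funTS; apply: measurable_funeM.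
  exact: measurable_cap_fun.
- by move=> k l _; exact: weight_term_ge0.
rewrite -sumEFin; apply: eq_bigr => k _.
rewrite ge0_integralZl//; last 3 first.
- by apply: measurable_funTS; exact: measurable_cap_fun.
- by move=> l _; exact: cube_ball_ge0.
- by rewrite lee_fin !mulr_ge0 ?add0r ?exprn_ge0 ?ramp_ge0.
rewrite add0r -/(cap _ _ _) EFinM.
have [->|k0] := posnP k; first by rewrite mulr0 !mul0r !mul0e.
by rewrite capE.
Qed.

End caps.

(** * Volume of the cross-polytope and of its parallel bodies *)

Section volumes.
Variable R : realType.
Local Notation mu n := (mmeasure (space R n)).

Lemma measurable_excess0_le n (r : R) :
  measurable [set p : mcarrier (space R n) | excess (vec p) 0 <= r].
Proof.
rewrite -[X in measurable X]setTI; apply: measurable_fun_le => //.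
exact: (measurable_fun_pair1 (0 : R) (@measurable_excess R n)).
Qed.

Lemma measurable_excess0_lt n (r : R) :
  measurable [set p : mcarrier (space R n) | excess (vec p) 0 < r].
Proof.
rewrite (_ : [set p | _] = ~` [set p : mcarrier (space R n) | r <= excess (vec p) 0]).
  apply: measurableC; rewrite -[X in measurable X]setTI; apply: measurable_fun_le => //.
  exact: (measurable_fun_pair1 (0 : R) (@measurable_excess R n)).
by apply/seteqP; split => p/=; rewrite ltNge => /negP.
Qed.

Lemma cross_polytope_preimage n (rho : R) : @vec R n @^-1` (cross_polytope rho n) =
  [set p : mcarrier (space R n) | excess (vec p) 0 <= rho].
Proof. by apply/seteqP; split => p; rewrite /cross_polytope/= excess0. Qed.

(** The weights for a = 1 and a = 0 at threshold 0 differ by the indicator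
    function of the polytope. Their integrals reduce to the term k = n, because
    a cube of side 0 has volume 0 in positive dimension. *)
Lemma measure_excess0_le n (rho : R) : 0 <= rho ->
  mu n [set p | excess (vec p) 0 <= rho] = (2 ^+ n * rho ^+ n / n`!%:R)%:E.
Proof.
move=> r0; set A := [set p | _].
have mA : measurable A by exact: measurable_excess0_le.
have intE (a : R) : 0 <= a ->
    (\int[mu n]_p (weight a rho 0 (vec p) 0)%:E
     = (2 ^+ n * (a + n%:R) * ramp n rho)%:E)%E.
  move=> a0; rewrite integral_weight// big_ord_recr/= big1 => [|k _].
    rewrite add0e /weight_term binn mul1r subnn /= expr0n/= mulr0 subr0 lexx.
    by rewrite mule1.
  rewrite /weight_term (_ : cube_ball _ _ _ = 0%E) ?mule0//.
  apply/eqP; rewrite eq_le cube_ball_ge0 andbT.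
  apply: le_trans (cube_ball_le _ _ (lexx 0)) _.
  by rewrite mulr0 expr0n subn_eq0 leqNgt ltn_ord.
have mw (a : R) : measurable_fun setT (fun p => (weight a rho 0 (@vec R n p) 0)%:E).
  apply/measurable_EFinP; exact: (measurable_fun_pair1 (0 : R) (@measurable_weight R n a rho 0)).
have clip0 p : clip_sq (@vec R n p) 0 = 0.
  by apply: big1 => i _; rewrite min_r// expr0n.
have : (\int[mu n]_p (weight 1 rho 0 (vec p) 0)%:E =
    mu n A + \int[mu n]_p (weight 0 rho 0 (vec p) 0)%:E)%E.
  rewrite -(setIT A) -integral_indic// -ge0_integralD//; last 3 first.
  - apply: eq_integral => p _; rewrite indicE /weight clip0 lexx andbT.
    have -> : (p \in A) = (excess (vec p) 0 <= rho) by apply/idP/idP; rewrite inE.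
    by case: ifP => h; rewrite -EFinD ?add0r ?addr0.
  - by apply/measurable_EFinP; exact: measurable_indic.
  - by move=> p _; rewrite lee_fin weight_ge0.
rewrite !intE// => E.
have : mu n A \is a fin_num.
  rewrite ge0_fin_numE//; apply: le_lt_trans (ltry (2 ^+ n * (1 + n%:R) * ramp n rho)).
  by rewrite E leeDl// lee_fin !mulr_ge0 ?exprn_ge0 ?ramp_ge0// add0r.
move: E; case: (mu n A) => // v /eqP; rewrite -EFinD eqe => /eqP E _.
congr (_%:E); have -> : v = 2 ^+ n * ramp n rho.
  by apply: (addIr (2 ^+ n * (0 + n%:R) * ramp n rho)); rewrite -E; ring.
by rewrite /ramp r0 mulrA.
Qed.

Lemma volume_cross_polytope n (rho : R) : 0 <= rho ->
  volume (cross_polytope rho n) = (2 ^+ n * rho ^+ n / n`!%:R)%:E.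
Proof. by move=> r0; rewrite volumeE cross_polytope_preimage measure_excess0_le. Qed.

(** Up to the continuous correction G, the hypotheses bound f from above by the
    right difference quotients of P and from below by the left ones. *)
Lemma squeeze_deriv_poly (P G : {poly R}) (f : R -> R) (rho : R) : 0 < rho ->
  (forall r h, 0 < r -> 0 < h -> P.[r] + h * f r <= P.[r + h] + h * G.[r + h]) ->
  (forall r h, 0 < r -> 0 < h -> P.[r + h] + h * G.[r] <= P.[r] + h * f (r + h)) ->
  f rho = P^`().[rho] + G.[rho].
Proof.
move=> r0 up lo.
pose D h := h^-1 *: (P.[h *: 1 + rho] - P.[rho]) + G.[h + rho].
have cD : D h @[h --> 0^'] --> P^`().[rho] + G.[rho].
  apply: cvgD.
    by rewrite derivE derive1E; exact: (@derivable_horner R P rho).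
  have ch : h + rho @[h --> (0 : R)^'] --> rho.
    by rewrite -[X in _ --> X]add0r; apply: cvgD; [exact: cvg_within|exact: cvg_cst].
  apply: cvg_comp ch _; exact: continuous_horner.
apply/eqP; rewrite eq_le; apply/andP; split.
  apply: (cvgr_to_ge (F := 0^'+) (f := D)).
    exact: cvg_dnbhs_at_right.
  near=> h; have h0 : 0 < h by near: h; exact: nbhs_right_gt.
  have := up rho h r0 h0; rewrite /D /GRing.scale/= mulr1 (addrC h rho) => H.
  by rewrite -lerBlDr ler_pdivlMl//; lra.
apply: (cvgr_to_le (F := 0^'-) (f := D)).
  exact: cvg_dnbhs_at_left.
near=> h; have h0 : h < 0 by near: h; exact: nbhs_left_lt.
have hr : - rho < h by near: h; apply: nbhs_left_gt; rewrite oppr_lt0.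
have := lo (h + rho) (- h); rewrite addrAC subrr add0r.
rewrite /D /GRing.scale/= mulr1 oppr_gt0 => /(_ _ h0) H.
have {}H := H ltac:(lra).
by rewrite -lerBrDr ler_ndivrMl//; lra.
Unshelve. all: by end_near. Qed.

End volumes.

Section volumes.
Variable R : realType.
Local Notation leb := (@lebesgue_measure R).
Local Notation mu n := (mmeasure (space R n)).

(** Integral over the radius, up to the variable, of the volume of the parallel
    body minus that of the polytope. *)
Definition layer_poly n (t : R) : {poly R} :=
  \sum_(k < n.+1) ('C(n, k)%:R * 2 ^+ k * k%:R / k`!%:R *
     (t ^+ (n - k).+1 * cap_volume R (n - k) k)) *: 'X^k.

Lemma layer_polyE n (rho t : R) : 0 <= rho -> 0 < t ->
  (\int[mu n]_x \int[leb]_(l in `[0%R, +oo[) (weight 0 rho (t ^+ 2) (vec x) l)%:E =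
   ((layer_poly n t).[rho])%:E)%E.
Proof.
move=> r0 t0; rewrite integral_layers//; congr (_%:E).
rewrite /layer_poly horner_sum; apply: eq_bigr => k _.
by rewrite hornerZ hornerXn /ramp r0; ring.
Qed.

(** The truncation grows by the full step h wherever r - u is already
    nonnegative. *)
Lemma ramp_step_ge (r h u : R) : 0 <= h ->
  Num.max (r - u) 0 + h * (if u <= r then 1 else 0) <= Num.max (r + h - u) 0.
Proof.
move=> h0; case: (leP u r) => ur; first by rewrite !max_l; lra.
by rewrite (max_r (_ : r - u <= 0)) ?mulr0 ?addr0 ?le_max ?lexx ?orbT//; lra.
Qed.

Lemma ramp_step_le (r h u : R) : 0 <= h ->
  Num.max (r + h - u) 0 <= Num.max (r - u) 0 + h * (if u <= r + h then 1 else 0).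
Proof.
move=> h0; case: (leP u (r + h)) => ur.
  by rewrite max_l ?subr_ge0// mulr1 -lerBlDr le_max; apply/orP; left; lra.
rewrite max_r ?subr_le0 ?(ltW ur)// mulr0 addr0.
by rewrite le_max lexx orbT.
Qed.

Lemma layer_step_ge (r h u v : R) : 0 <= h ->
  Num.max (r - u) 0 - Num.max (r - v) 0 + h * (if u <= r then 1 else 0) <=
  Num.max (r + h - u) 0 - Num.max (r + h - v) 0 +
    h * (if v <= r + h then 1 else 0).
Proof.
by move=> h0; have := ramp_step_ge r u h0; have := ramp_step_le r v h0; lra.
Qed.

Lemma layer_step_le (r h u v : R) : 0 <= h ->
  Num.max (r + h - u) 0 - Num.max (r + h - v) 0 + h * (if v <= r then 1 else 0) <=
  Num.max (r - u) 0 - Num.max (r - v) 0 + h * (if u <= r + h then 1 else 0).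
Proof.
by move=> h0; have := ramp_step_ge r v h0; have := ramp_step_le r u h0; lra.
Qed.

(** With f the volume of the parallel body and G that of the polytope as
    functions of the radius, integrating [layer_step_ge] and [layer_step_le]
    over x compares f - G with the difference quotients of [layer_poly]; as the
    latter is a polynomial in the radius, f - G is its derivative. *)
Lemma volume_parallel_cross_polytope n (rho t : R) : 0 < rho -> 0 < t ->
  measurable (vec @^-1` parallel_set (@cross_polytope R rho n) t) /\
  volume (parallel_set (cross_polytope rho n) t) =
    ((layer_poly n t)^`().[rho] + 2 ^+ n * rho ^+ n / n`!%:R)%:E.
Proof.
move=> r0 t0; have s0 : 0 <= t ^+ 2 by exact: sqr_ge0.
pose phi (p : mcarrier (space R n)) : R := projT1 (cid (distance_threshold (vec p) s0)).
have [phi_le phiP phi_int] : [/\ forall p, phi p <= excess (vec p) 0,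
   forall p r, 0 <= r -> phi p <= r <-> parallel_set (cross_polytope r n) t (vec p) &
   forall p r, 0 < r -> (\int[leb]_(l in `[0%R, +oo[) (weight 0 r (t ^+ 2) (vec p) l)%:E
         = (Num.max (r - phi p) 0 - Num.max (r - excess (vec p) 0) 0)%:E)%E].
  split=> [p|p r r1|p r r1]; rewrite /phi; case: (cid _) => //= y [h1 h2 h3] //.
  - by rewrite parallel_cross_polytopeP//; exact: h2.
  - exact: h3.
pose q r p := (\int[leb]_(l in `[0%R, +oo[) (weight 0 r (t ^+ 2) (@vec R n p) l)%:E)%E.
have mq r : measurable_fun setT (q r).
  rewrite /q; under eq_fun do rewrite integral_mkcond.
  exact: (measurable_fun_fubini_tonelli_F _ (@measurable_layers R n r _) (layers_ge0 r _)).
have q0 r p : (0 <= q r p)%E.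
  by apply: integral_ge0 => l _; rewrite lee_fin weight_ge0.
(* q r is positive exactly on the part of {phi < r} outside the polytope of
   radius r, which makes the sublevel sets of phi measurable. *)
have mlt r : 0 < r -> measurable [set p | phi p < r].
  move=> r1; rewrite (_ : [set p | _] =
     [set p | (0 < q r p)%E] `|` [set p | excess (vec p) 0 < r]).
    apply: measurableU; last exact: measurable_excess0_lt.
    by rewrite -[X in measurable X]setTI; exact: emeasurable_fun_o_infty.
  apply/seteqP; split => p/=; rewrite /q phi_int// lte_fin subr_gt0; last first.
    case=> [|xr]; last exact: le_lt_trans (phi_le p) xr.
    by case: (leP (r - phi p) 0) => ?; case: (leP (r - excess (vec p) 0) 0) => ?; lra.
  move=> pr; have [rx|xr] := leP r (excess (vec p) 0); [left|by right].
  by rewrite (max_r (_ : r - excess (vec p) 0 <= 0)) ?subr_le0// lt_max subr_gt0 pr.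
have mle r : 0 < r -> measurable [set p | phi p <= r].
  move=> r1; rewrite (_ : [set p | _] = \bigcap_k [set p | phi p < r + k.+1%:R^-1]).
    apply: bigcapT_measurable => k; apply: mlt.
    by rewrite addr_gt0// invr_gt0.
  apply/seteqP; split => p/=.
    by move=> pr k _; rewrite /= (le_lt_trans pr)// ltrDl invr_gt0.
  move=> H; rewrite leNgt; apply/negP => /ltr_add_invr[k].
  by apply/negP; rewrite -leNgt; apply: ltW; exact: H.
have mn1 r := measurable_excess0_le n r.
have int_step (r h : R) (A : set (mcarrier (space R n))) : 0 < r -> 0 < h -> measurable A ->
   (\int[mu n]_p (q r p + h%:E * (\1_A p)%:E) = ((layer_poly n t).[r])%:E + h%:E * mu n A)%E.
  move=> r1 h0 mA; rewrite ge0_integralD//; last 2 first.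
  - by move=> p _; rewrite -EFinM lee_fin mulr_ge0 ?(ltW h0).
  - by apply: measurable_funeM; apply/measurable_EFinP; exact: measurable_indic.
  rewrite ge0_integralZl ?lee_fin ?(ltW h0)//; last first.
    by apply/measurable_EFinP; exact: measurable_indic.
  by rewrite integral_indic// setIT layer_polyE// ltW.
have ind (P : set (mcarrier (space R n))) p (b : bool) : (P p <-> b) ->
    (\1_P p : R) = if b then 1 else 0.
  by move=> Pb; rewrite indicE; case: b Pb => -[h1 h2];
    [rewrite mem_set//; exact: h2|rewrite memNset// => /h1].
have up r h : 0 < r -> 0 < h ->
   (((layer_poly n t).[r])%:E + h%:E * mu n [set p | (phi p <= r)%R] <=
    ((layer_poly n t).[r + h])%:E + h%:E * mu n [set p | (excess (vec p) 0 <= r + h)%R])%E.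
  move=> r1 h0; have rh0 : 0 < r + h by lra.
  rewrite -(int_step r h)//; last exact: mle.
  rewrite -(int_step (r + h) h)//.
  apply: ge0_le_integral => //.
  - by move=> p _; rewrite adde_ge0// -EFinM lee_fin mulr_ge0// ltW.
  - apply: emeasurable_funD => //; apply: measurable_funeM.
    by apply/measurable_EFinP; apply: measurable_indic; exact: mle.
  - apply: emeasurable_funD => //; apply: measurable_funeM.
    by apply/measurable_EFinP; apply: measurable_indic; exact: mn1.
  move=> p _; rewrite /q !phi_int// -!EFinM -!EFinD lee_fin.
  rewrite (ind _ _ (phi p <= r))// (ind _ _ (excess (vec p) 0 <= r + h))//.
  by apply: layer_step_ge; exact: ltW.
have lo r h : 0 < r -> 0 < h ->
   (((layer_poly n t).[r + h])%:E + h%:E * mu n [set p | (excess (vec p) 0 <= r)%R] <=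
    ((layer_poly n t).[r])%:E + h%:E * mu n [set p | (phi p <= r + h)%R])%E.
  move=> r1 h0; have rh0 : 0 < r + h by lra.
  rewrite -(int_step r h)//; last exact: mle.
  rewrite -(int_step (r + h) h)//.
  apply: ge0_le_integral => //.
  - by move=> p _; rewrite adde_ge0// -EFinM lee_fin mulr_ge0// ltW.
  - apply: emeasurable_funD => //; apply: measurable_funeM.
    by apply/measurable_EFinP; apply: measurable_indic; exact: mn1.
  - apply: emeasurable_funD => //; apply: measurable_funeM.
    by apply/measurable_EFinP; apply: measurable_indic; exact: mle.
  move=> p _; rewrite /q !phi_int// -!EFinM -!EFinD lee_fin.
  rewrite (ind _ _ (excess (vec p) 0 <= r))// (ind _ _ (phi p <= r + h))//.
  by apply: layer_step_le; exact: ltW.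
have fin r : 0 < r -> mu n [set p | phi p <= r] \is a fin_num.
  move=> r1; rewrite ge0_fin_numE//.
  have := up r 1 r1 ltr01; rewrite !mul1e measure_excess0_le; last by lra.
  by case: (mu n _) => [v| |] //=; rewrite ?ltry// ?addey// leye_eq.
pose f r := fine (mu n [set p | phi p <= r]).
pose G : {poly R} := (2 ^+ n / n`!%:R) *: 'X^n.
have GE r : 2 ^+ n * r ^+ n / n`!%:R = G.[r] by rewrite hornerZ hornerXn; ring.
have KE : vec @^-1` parallel_set (cross_polytope rho n) t = [set p | phi p <= rho].
  by apply/seteqP; split => p /=; rewrite phiP// ltW.
split; first by rewrite KE; exact: mle.
rewrite GE -(@squeeze_deriv_poly _ _ _ f)//; last 2 first.
- move=> r h r1 h0; have := up r h r1 h0.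
  rewrite measure_excess0_le; last by lra.
  by rewrite GE -(fineK (fin r r1)) -!EFinM -!EFinD lee_fin.
- move=> r h r1 h0; have := lo r h r1 h0.
  rewrite measure_excess0_le; last by lra.
  by rewrite GE -(fineK (fin (r + h) (addr_gt0 r1 h0))) -!EFinM -!EFinD lee_fin.
by rewrite /f fineK ?fin// volumeE KE.
Qed.

End volumes.

(** * Boundary of the cross-polytope *)

Section boundary.
Variable R : realType.

Lemma continuous_excess0 n : continuous (fun x : 'rV[R]_n => excess x 0).
Proof.
rewrite (_ : (fun _ => _) = fun x : 'rV[R]_n => \sum_(i < n) `|x 0 i|); last first.
  by apply/funext => x; rewrite excess0.
apply: continuous_big => [|i _ x]; first exact: add_continuous.
apply: (@cvg_comp _ _ _ (fun x : 'rV[R]_n => x 0 i) (fun y : R => `|y|)).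
  exact: coord_continuous.
exact: norm_continuous.
Qed.

Lemma excess0Z n a (x : 'rV[R]_n) : excess (a *: x) 0 = `|a| * excess x 0.
Proof. by rewrite !excess0 mulr_sumr; apply: eq_bigr => i _; rewrite mxE normrM. Qed.

Lemma boundary_cross_polytope n (rho : R) : 0 < rho ->
  boundary (cross_polytope rho n) = [set x | excess x 0 = rho].
Proof.
move=> r0; have CE : cross_polytope rho n = [set x | excess x 0 <= rho].
  by apply/seteqP; split => x; rewrite /cross_polytope/= excess0.
have clC : closed (cross_polytope rho n).
  rewrite CE; apply: (@closed_comp _ _ (fun x : 'rV[R]_n => excess x 0) [set y | y <= rho]).
    by move=> x _; exact: continuous_excess0.
  exact: closed_le.
rewrite /boundary -(closure_id _).1//; apply/seteqP; split => x /=.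
  move=> [Cx nx]; apply/eqP; rewrite eq_le; move: (Cx); rewrite {1}CE/= => -> /=.
  rewrite leNgt; apply/negP => xr; apply: nx.
  have /cvgr_lt/(_ _ xr) := @continuous_excess0 n x.
  by apply: filterS => y; rewrite CE/=; exact: ltW.
move=> xr; split; first by rewrite CE/= xr.
(* A boundary point is pushed outside by any dilation of ratio above 1. *)
move=> Cx; have cx : (a *: x) @[a --> (1 : R)] --> x.
  rewrite -[X in _ --> X]scale1r; apply: cvgZ; [exact: cvg_id|exact: cvg_cst].
have := cvg_at_right_filter cx => /(_ _ Cx) [e /= e0 He].
have := He (1 + e / 2); rewrite /= ltrDl divr_gt0//= CE/= excess0Z xr.
rewrite distrC addrAC subrr add0r !gtr0_norm; try lra.
move=> /(_ ltac:(lra) isT).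
by rewrite -ler_pdivlMr// divff; lra.
Qed.

(** Cauchy-Schwarz inequality against the constant vector 1. *)
Lemma sum_norm_le_sqrt n (y : 'I_n -> R) (t : R) : (0 < n)%N -> 0 < t ->
  \sum_i y i ^+ 2 <= t ^+ 2 -> \sum_i `|y i| <= t * Num.sqrt n%:R.
Proof.
move=> n0 t0 yt; have sn : 0 < Num.sqrt n%:R :> R by rewrite sqrtr_gt0 ltr0n.
(* 2 |y| <= y^2 / c + c, where c is the common value of |y i| in the case
   of equality. *)
pose c := t / Num.sqrt n%:R; have c0 : 0 < c by rewrite divr_gt0.
have sn2 : Num.sqrt n%:R ^+ 2 = n%:R :> R by rewrite sqr_sqrtr.
have H : \sum_i `|y i| <= \sum_i (y i ^+ 2 / c + c) / 2.
  apply: ler_sum => i _; rewrite ler_pdivlMr// -(ler_pM2r c0) mulrDl divfK ?gt_eqF//.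
  have := sqr_ge0 (`|y i| - c); rewrite sqrrB real_normK ?num_real//; lra.
apply: le_trans H _; rewrite -mulr_suml big_split/= -mulr_suml sumr_const card_ord.
rewrite -(mulr_natl c) ler_pdivrMr//.
have -> : t * Num.sqrt n%:R * 2 = t ^+ 2 / c + n%:R * c.
  by rewrite -[X in X * c]sn2 /c; field; rewrite !gt_eqF.
by rewrite lerD2r ler_pM2r ?invr_gt0.
Qed.

Lemma excess0_parallel n (A : set 'rV[R]_n) (t : R) (x : 'rV[R]_n) :
  (0 < n)%N -> 0 < t -> parallel_set A t x ->
  exists a, [/\ A a, excess x 0 <= excess a 0 + t * Num.sqrt n%:R &
                     excess a 0 <= excess x 0 + t * Num.sqrt n%:R].
Proof.
move=> n0 t0 /parallel_setP-/(_ t0)[a Aa xa]; exists a.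
have H := sum_norm_le_sqrt n0 t0 xa; rewrite !excess0; split => //.
  apply: le_trans (lerD (lexx _) H); rewrite -big_split/=.
  by apply: ler_sum => i _; rewrite -{1}(subrK (a 0 i) (x 0 i)) addrC ler_normD.
apply: le_trans (lerD (lexx _) H); rewrite -big_split/=.
apply: ler_sum => i _; rewrite distrC -{1}(subrK (x 0 i) (a 0 i)) addrC.
exact: ler_normD.
Qed.

(** Outside the polytope, the distance to the boundary is the distance to the
    polytope; inside, a point of l1-norm r is at distance (rho - r) / sqrt n
    from the boundary, in a direction normal to a facet. *)
Lemma parallel_boundary_cross_polytope n (rho t : R) : (0 < n)%N -> 0 < rho -> 0 < t ->
  parallel_set (boundary (cross_polytope rho n)) t =
  parallel_set (cross_polytope rho n) t `\`
    [set x | excess x 0 < rho - t * Num.sqrt n%:R].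
Proof.
move=> n0 r0 t0; rewrite boundary_cross_polytope//; apply/seteqP; split => x /=.
  move=> px; split.
    move/parallel_setP : px => /(_ t0)[a /= ar xa].
    apply/parallel_setP => //; exists a => //.
    by rewrite /cross_polytope/= -excess0 ar.
  apply/negP; rewrite -leNgt lerBlDr.
  by have [a [/= <-]] := excess0_parallel n0 t0 px.
move=> [/parallel_cross_polytopeP-/(_ (ltW r0) t0)[l [l0 xl xt]]].
move=> /negP; rewrite -leNgt => rx; apply/parallel_setP => //.
(* Outside, shrink x until it reaches the boundary; inside, move all
   coordinates outwards by the same amount d. *)
have [xr|xr] := leP rho (excess x 0).
  have [|m /andP[m0 ml] xm] := @excess_ivt _ _ x rho l l0; first by rewrite xl.
  exists (\row_i soft m (x 0 i)).
    by rewrite /= excess0 -xm; apply: eq_bigr => i _; rewrite mxE norm_soft.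
  apply: le_trans (le_trans (le_clip_sq x m0 ml) xt).
  by apply: ler_sum => i _; rewrite mxE sub_soft.
pose d : R := (rho - excess x 0) / n%:R.
have nR : 0 < n%:R :> R by rewrite ltr0n.
have d0 : 0 <= d by rewrite divr_ge0 ?subr_ge0 ?ltW.
exists (\row_i (x 0 i + if 0 <= x 0 i then d else - d)).
  rewrite /= excess0 (eq_bigr (fun i => `|x 0 i| + d)) => [|i _].
    rewrite big_split/= -excess0 sumr_const card_ord -(mulr_natl d) mulrC.
    by rewrite divfK ?gt_eqF//; lra.
  rewrite mxE; case: leP => xi; first by rewrite !ger0_norm ?addr_ge0.
  by rewrite !ler0_norm; lra.
rewrite (eq_bigr (fun=> d ^+ 2)) => [|i _]; last first.
  by rewrite mxE; case: ifP => _; ring.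
rewrite sumr_const card_ord -(mulr_natl (d ^+ 2)).
have dt : d * Num.sqrt n%:R <= t.
  have sn : 0 < Num.sqrt n%:R :> R by rewrite sqrtr_gt0.
  rewrite -(ler_pM2r sn) -mulrA -expr2 sqr_sqrtr ?(ltW nR)// divfK ?gt_eqF//; lra.
rewrite -[n%:R]sqr_sqrtr ?(ltW nR)// -exprMn mulrC lerXn2r ?nnegrE ?(ltW t0)//.
by rewrite mulr_ge0 ?sqrtr_ge0.
Qed.

(** The ball of radius t is contained in the cross-polytope of radius t sqrt n,
    as the inradius of the latter is t. *)
Lemma parallel_cross_polytope_subset n (rho t : R) : (0 < n)%N -> 0 < t ->
  parallel_set (cross_polytope rho n) t `<=` cross_polytope (rho + t * Num.sqrt n%:R) n.
Proof.
move=> n0 t0 x /(excess0_parallel n0 t0)[a []].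
by rewrite /cross_polytope/= -!excess0; lra.
Qed.

End boundary.

(** * The Steiner polynomial *)

Section steiner.
Variable R : realType.
Local Notation mu n := (mmeasure (space R n)).

Definition polytope_volume n (rho : R) : R := 2 ^+ n * rho ^+ n / n`!%:R.

(** Contribution to the coefficient of t^(n - k + 1) of the points whose
    projection lies in the relative interior of a face with k vertices. *)
Definition steiner_coef n (rho : R) (k : nat) : R :=
  'C(n, k)%:R * 2 ^+ k * k%:R / k`!%:R * cap_volume R (n - k) k * (k%:R * rho ^+ k.-1).

Definition polytope_steiner n (rho : R) : {poly R} :=
  (polytope_volume n rho)%:P + \sum_(i < n) steiner_coef n rho (n - i) *: 'X^(i.+1).

Lemma polytope_volume_gt0 n (rho : R) : 0 < rho -> 0 < polytope_volume n rho.
Proof. by move=> r0; rewrite divr_gt0 ?mulr_gt0 ?exprn_gt0 ?ltr0n ?fact_gt0. Qed.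

Lemma horner_polytope_steiner n (rho t : R) :
  (polytope_steiner n rho).[t] =
  polytope_volume n rho + \sum_(i < n) steiner_coef n rho (n - i) * t ^+ i.+1.
Proof.
rewrite hornerD hornerC horner_sum; congr (_ + _).
by apply: eq_bigr => i _; rewrite hornerZ hornerXn.
Qed.

Lemma volume_parallel_polytope n (rho t : R) : 0 < rho -> 0 < t ->
  volume (parallel_set (cross_polytope rho n) t) = ((polytope_steiner n rho).[t])%:E.
Proof.
move=> r0 t0; have [_ ->] := volume_parallel_cross_polytope n r0 t0.
rewrite addrC horner_polytope_steiner; congr (_ + _)%:E.
rewrite /layer_poly linear_sum horner_sum (reindex_inj rev_ord_inj)/= big_ord_recr/=.
rewrite subnn mulr0 !mul0r scale0r linear0 horner0 addr0.
apply: eq_bigr => i _; rewrite derivZ derivXn hornerZ hornerMn hornerXn.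
rewrite subSS /steiner_coef subKn ?(ltnW (ltn_ord i))//.
by rewrite -(mulr_natl _ (n - i)); ring.
Qed.

Lemma poly_eq_pos (p q : {poly R}) : (forall t, 0 < t -> p.[t] = q.[t]) -> p = q.
Proof.
move=> pq; apply/eqP; rewrite -subr_eq0.
apply/eqP; apply: (@roots_geq_poly_eq0 _ _ [seq i.+1%:R | i <- iota 0 (size (p - q)).+1]).
- apply/allP => _ /mapP[i _ ->]; rewrite rootE hornerD hornerN pq ?subrr//.
- rewrite map_inj_uniq ?iota_uniq// => i k /eqP; rewrite eqr_nat => /eqP[].
  by [].
- by rewrite size_map size_iota.
Qed.

(** A polynomial is determined by its values at positive numbers, so the chosen
    polynomial is the explicit one. *)
Lemma steiner_poly_cross_polytope n (rho : R) : 0 < rho ->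
  steiner_poly (cross_polytope rho n) = polytope_steiner n rho.
Proof.
move=> r0; rewrite /steiner_poly; set P := [set p | _].
have Pp : P (polytope_steiner n rho) by move=> t t0; exact: volume_parallel_polytope.
have := xgetPex 0 (ex_intro _ _ Pp) => H; apply: poly_eq_pos => t t0.
by apply/EFin_inj; rewrite -(H t t0) -(Pp t t0).
Qed.

(** The volume of the open polytope is squeezed between those of smaller closed
    ones and of the closed one. *)
Lemma measure_excess0_lt n (r : R) : 0 < r ->
  mu n [set p | excess (vec p) 0 < r] = (polytope_volume n r)%:E.
Proof.
move=> r0; apply/eqP; rewrite eq_le; apply/andP; split.
  rewrite -(measure_excess0_le n (ltW r0)); apply: le_measure; rewrite ?inE.
  - exact: measurable_excess0_lt.
  - exact: measurable_excess0_le.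
  - by move=> p /=; exact: ltW.
have lower s : 0 < s -> s < r ->
    ((polytope_volume n s)%:E <= mu n [set p | (excess (vec p) 0 < r)%R])%E.
  move=> s0 sr; rewrite -(measure_excess0_le n (ltW s0)); apply: le_measure; rewrite ?inE.
  - exact: measurable_excess0_le.
  - exact: measurable_excess0_lt.
  - by move=> p /= ps; exact: le_lt_trans sr.
move: lower; case: (mu n _) => [v| |] lower; last 2 first.
- by rewrite leey.
- by have := lower (r / 2); rewrite leeNy_eq divr_gt0// => /(_ isT ltac:(lra)).
rewrite lee_fin.
have GE s : polytope_volume n s = ((2 ^+ n / n`!%:R) *: 'X^n).[s].
  by rewrite hornerZ hornerXn /polytope_volume; ring.
rewrite GE; apply: (cvgr_to_le (F := r^'-) (f := horner ((2 ^+ n / n`!%:R) *: 'X^n))).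
  by apply: cvg_at_left_filter; exact: continuous_horner.
near=> s; rewrite -GE -lee_fin; apply: lower.
  by near: s; exact: nbhs_left_gt.
by near: s; exact: nbhs_left_lt.
Unshelve. all: by end_near. Qed.

Lemma volume_parallel_boundary n (rho t : R) : (0 < n)%N -> 0 < rho -> 0 < t ->
  t * Num.sqrt n%:R < rho ->
  volume (parallel_set (boundary (cross_polytope rho n)) t) =
  ((polytope_steiner n rho).[t] - polytope_volume n (rho - t * Num.sqrt n%:R))%:E.
Proof.
move=> n0 r0 t0 tr; have [mK _] := volume_parallel_cross_polytope n r0 t0.
have tr0 : 0 < rho - t * Num.sqrt n%:R by rewrite subr_gt0.
rewrite parallel_boundary_cross_polytope// volumeE.
rewrite [LHS](_ : _ = mu n (@vec R n @^-1` parallel_set (cross_polytope rho n) t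
  `\` [set p | excess (@vec R n p) 0 < rho - t * Num.sqrt n%:R]))//.
have KE := volume_parallel_polytope n r0 t0; rewrite volumeE in KE.
rewrite measureD//; last 2 first.
- exact: measurable_excess0_lt.
- by move: KE => /= ->; exact: ltry.
rewrite EFinB -measure_excess0_lt// -KE.
congr (_ - mu n _)%E; apply/seteqP; split => p /=; first by case.
move=> pr; split => //; apply/parallel_setP => //; exists (vec p).
  rewrite /cross_polytope/= -excess0 ltW// (lt_le_trans pr)// gerBl.
  by rewrite mulr_ge0 ?sqrtr_ge0 ?ltW.
by rewrite big1 ?sqr_ge0// => i _; rewrite subrr expr0n.
Qed.

End steiner.

(** * The shape factor *)

Section shape.
Variable R : realType.

(** The outer and the inner layer of the boundary contribute equally, hence the
    factor 2, which the length 2 t in the Minkowski content removes. *)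
Lemma deriv_boundary_volume n (rho : R) : (0 < n)%N -> 0 < rho ->
  (polytope_steiner n rho - (((2 ^+ n / n`!%:R) *: 'X^n) \Po
     (rho%:P - Num.sqrt n%:R *: 'X)))^`().[0] =
  2 * (n%:R * Num.sqrt n%:R / rho * polytope_volume n rho).
Proof.
move=> n0 r0.
have sn : Num.sqrt n%:R != 0 :> R by rewrite gt_eqF// sqrtr_gt0 ltr0n.
have sn2 : Num.sqrt n%:R ^+ 2 = n%:R :> R by rewrite sqr_sqrtr.
have fn : n`!%:R != 0 :> R by rewrite pnatr_eq0 -lt0n fact_gt0.
rewrite derivB hornerD hornerN deriv_comp hornerM.
rewrite /polytope_steiner derivD derivC add0r linear_sum/= horner_sum.
case: n n0 sn sn2 fn => // n _ sn sn2 fn.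
rewrite big_ord_recl/= big1 => [|i _]; last first.
  by rewrite derivZ derivXn hornerZ hornerMn hornerXn /bump/= add1n expr0n/= mul0rn mulr0.
rewrite derivZ derivXn hornerZ hornerMn hornerXn expr0/= !subn0 addr0.
rewrite horner_comp derivB derivC sub0r !derivZ derivX derivXn !hornerE hornerMn !hornerE/=.
rewrite ?mulr0 ?subr0 /steiner_coef subnn cap_volume0// binn /polytope_volume.
rewrite -(mulr_natl (rho ^+ n) n.+1) (exprS rho) /=.
have r1 : rho != 0 by rewrite gt_eqF.
set s := Num.sqrt _ in sn sn2 *; rewrite -sn2; field.
by rewrite r1 sn fn.
Qed.

Lemma shape_factor_cross_polytope n (rho : R) : (0 < n)%N -> 0 < rho ->
  shape_factor (cross_polytope rho n) = n%:R * Num.sqrt n%:R / rho.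
Proof.
move=> n0 r0; have V0 := polytope_volume_gt0 n r0.
rewrite /shape_factor volume_cross_polytope ?ltW//= -/(polytope_volume n rho).
apply: (canLR (mulfK (lt0r_neq0 V0))).
set W := (polytope_steiner n rho - (((2 ^+ n / n`!%:R) *: 'X^n) \Po
     (rho%:P - Num.sqrt n%:R *: 'X))).
have W' : W^`().[0] = 2 * (n%:R * Num.sqrt n%:R / rho * polytope_volume n rho).
  exact: deriv_boundary_volume.
have WE t : W.[t] = (polytope_steiner n rho).[t] - polytope_volume n (rho - t * Num.sqrt n%:R).
  rewrite /W hornerD hornerN horner_comp !hornerE /polytope_volume; congr (_ - _).
  by rewrite mulrC mulrA (mulrC _ t); ring.
have W0 : W.[0] = 0.
  rewrite WE mul0r subr0 horner_polytope_steiner big1 ?addr0 ?subrr// => i _.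
  by rewrite expr0n mulr0.
apply/cvg_lim => //.
have cW : h^-1 *: (W.[h *: 1 + 0] - W.[0]) @[h --> (0 : R)^'] --> W^`().[0].
  by rewrite derivE derive1E; exact: (@derivable_horner R W 0).
have {}cW : (2^-1 * (h^-1 * W.[h])) @[h --> (0 : R)^'+] -->
    n%:R * Num.sqrt n%:R / rho * polytope_volume n rho.
  rewrite (_ : _ / rho * _ = 2^-1 * W^`().[0]); last by rewrite W' mulKf.
  apply: cvgM; first exact: cvg_cst.
  apply: cvg_dnbhs_at_right; apply: cvg_trans cW.
  apply: near_eq_cvg; near=> h.
  by rewrite W0 subr0 addr0 /GRing.scale/= mulr1.
have sn : 0 < Num.sqrt n%:R :> R by rewrite sqrtr_gt0 ltr0n.
apply: cvg_trans cW; apply: near_eq_cvg; near=> t.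
have t0 : 0 < t by near: t; exact: nbhs_right_gt.
rewrite volume_parallel_boundary//=; last first.
  by rewrite -ltr_pdivlMr//; near: t; apply: nbhs_right_lt; exact: divr_gt0.
by rewrite -WE invfM; ring.
Unshelve. all: by end_near. Qed.

End shape.

(** * Bounds on the renormalized polynomial *)

Section coefficients.
Variable R : realType.

(** Coefficient of tau^(i + 1); the constant coefficient is 1. *)
Definition renormalized_coef n (rho : R) (i : nat) : R :=
  steiner_coef n rho (n - i) / polytope_volume n rho /
    (n%:R * Num.sqrt n%:R / rho) ^+ i.+1.

Lemma renormalized_cross_polytope n (rho : R) : (0 < n)%N -> 0 < rho ->
  renormalized_steiner_poly (cross_polytope rho n) =
  1 + \sum_(i < n) renormalized_coef n rho i *: 'X^(i.+1).
Proof.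
move=> n0 r0; have V0 := polytope_volume_gt0 n r0.
rewrite /renormalized_steiner_poly shape_factor_cross_polytope// volume_cross_polytope ?ltW//=.
rewrite -/(polytope_volume n rho) steiner_poly_cross_polytope//.
rewrite comp_polyD comp_polyC linear_sum/= scalerDr -mul_polyC -polyCM mulVf ?gt_eqF//.
congr (_ + _); rewrite scaler_sumr; apply: eq_bigr => i _.
rewrite comp_polyZ comp_Xn_poly exprZn !scalerA; congr (_ *: _).
by rewrite /renormalized_coef exprVn; ring.
Qed.

(** Inserting [cap_volume_ge] leaves factorials and powers of n; the factorials
    combine into two falling factorials. *)
Lemma renormalized_coef_ge n (rho : R) i : (i < n)%N -> 0 < rho ->
  ((n ^_ i.+1)%:R / n%:R ^+ i.+1) ^+ 2 / (i.+1)`!%:R <= renormalized_coef n rho i.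
Proof.
move=> ilt r0; have n0 : (0 < n)%N by exact: leq_ltn_trans ilt.
have k0 : (0 < n - i)%N by rewrite subn_gt0.
have V0 := polytope_volume_gt0 n r0.
have sn : 0 < Num.sqrt n%:R :> R by rewrite sqrtr_gt0 ltr0n.
have sn2 : Num.sqrt n%:R ^+ 2 = n%:R :> R by rewrite sqr_sqrtr.
have nk : n%:R != 0 :> R by rewrite pnatr_eq0 -lt0n.
have fn m : m`!%:R != 0 :> R by rewrite pnatr_eq0 -lt0n fact_gt0.
have := cap_volume_ge R i k0; rewrite subnKC ?(ltnW ilt)// => cap.
pose A : R := 'C(n, n - i)%:R * 2 ^+ (n - i) * (n - i)%:R / (n - i)`!%:R *
  ((n - i)%:R * rho ^+ (n - i).-1) / polytope_volume n rho /
  (n%:R * Num.sqrt n%:R / rho) ^+ i.+1.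
have A0 : 0 <= A.
  apply: divr_ge0; last first.
    by rewrite exprn_ge0// divr_ge0 ?mulr_ge0 ?sqrtr_ge0 ?(ltW r0).
  apply: divr_ge0 (ltW V0).
  by rewrite !mulr_ge0 ?invr_ge0 ?exprn_ge0 ?(ltW r0).
have -> : renormalized_coef n rho i = A * cap_volume R i (n - i).
  rewrite /renormalized_coef /steiner_coef subKn ?(ltnW ilt)// /A.
  by ring.
apply: le_trans (ler_wpM2l A0 cap).
rewrite le_eqVlt; apply/orP; left; apply/eqP.
have e1 : 'C(n, n - i)%:R * (n - i)%:R = (n ^_ i.+1)%:R / i`!%:R :> R.
  apply: (mulIf (fn i)); rewrite divfK// -!natrM bin_sub ?(ltnW ilt)//.
  by rewrite mulnAC bin_ffact ffactnSr.
have e2 : (n - i)%:R / (n - i)`!%:R = (n ^_ i.+1)%:R / n`!%:R :> R.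
  apply: (mulIf (fn n)); rewrite divfK// mulrAC; apply: (mulIf (fn (n - i)%N)).
  by rewrite divfK// -!natrM -(ffact_fact (ltnW ilt)) ffactnSr; congr (_%:R); rewrite mulnCA mulnA.
transitivity (('C(n, n - i)%:R * (n - i)%:R) * ((n - i)%:R / (n - i)`!%:R) *
   (2 ^+ (n - i) * 2 ^+ i) * (rho ^+ (n - i).-1 * rho ^+ i.+1) /
   ((n%:R * Num.sqrt n%:R) ^+ i.+1 * Num.sqrt n%:R ^+ i.+1) / i.+1%:R / polytope_volume n rho);
  last first.
  by rewrite /A !exprMn !exprVn; field; rewrite !gt_eqF ?exprn_gt0 ?ltr0n// ?fact_gt0.
rewrite e1 e2 -!exprD subnK ?(ltnW ilt)// addnS -addSn prednK// subnK ?(ltnW ilt)//.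
have -> : (n%:R * Num.sqrt n%:R) ^+ i.+1 * Num.sqrt n%:R ^+ i.+1 = (n%:R ^+ i.+1) ^+ 2 :> R.
  by rewrite -exprMn -mulrA -[X in n%:R * X]expr2 sn2 -[n%:R * _]expr2 -!exprM mulnC.
rewrite /polytope_volume factS natrM; move: (i`!) (n`!) (fn i) (fn n) => a b a0 b0.
field.
by rewrite a0 b0 nat1r !gt_eqF ?exprn_gt0 ?ltr0n.
Qed.

(** By [parallel_cross_polytope_subset] the parallel body lies in the polytope
    dilated by 1 + T / n, whose relative volume is (1 + T / n)^n. *)
Lemma renormalized_le_expR n (rho T : R) : (0 < n)%N -> 0 < rho -> 0 <= T ->
  1 + \sum_(i < n) renormalized_coef n rho i * T ^+ i.+1 <= expR T.
Proof.
move=> n0 r0; rewrite le_eqVlt => /predU1P[<-|T0].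
  by rewrite expR0 big1 ?addr0// => i _; rewrite expr0n mulr0.
have V0 := polytope_volume_gt0 n r0.
have nR : 0 < n%:R :> R by rewrite ltr0n.
have sn : 0 < Num.sqrt n%:R :> R by rewrite sqrtr_gt0.
have s0 : 0 < n%:R * Num.sqrt n%:R / rho by rewrite divr_gt0 ?mulr_gt0.
pose t := T / (n%:R * Num.sqrt n%:R / rho).
have t0 : 0 < t by rewrite divr_gt0.
have r1 : 0 < rho + t * Num.sqrt n%:R by apply: addr_gt0 => //; exact: mulr_gt0.
have -> : 1 + \sum_(i < n) renormalized_coef n rho i * T ^+ i.+1 =
    (polytope_steiner n rho).[t] / polytope_volume n rho.
  rewrite horner_polytope_steiner mulrDl divff ?gt_eqF// mulr_suml; congr (_ + _).
  have h (c V D u : R) : c / V / D * u = c * (u / D) / V by ring.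
  by apply: eq_bigr => i _; rewrite /renormalized_coef h -expr_div_n.
have H : (polytope_steiner n rho).[t] <= polytope_volume n (rho + t * Num.sqrt n%:R).
  rewrite -lee_fin -volume_parallel_polytope// -volume_cross_polytope ?(ltW r1)//.
  rewrite !volumeE; apply: le_measure; rewrite ?inE.
  - by have [] := volume_parallel_cross_polytope n r0 t0.
  - by rewrite cross_polytope_preimage; exact: measurable_excess0_le.
  - by move=> p /=; exact: parallel_cross_polytope_subset.
rewrite ler_pdivrMr//; apply: le_trans H _.
have -> : polytope_volume n (rho + t * Num.sqrt n%:R) = (1 + T / n%:R) ^+ n * polytope_volume n rho.
  rewrite /polytope_volume (_ : rho + _ = (1 + T / n%:R) * rho); last first.
    by rewrite /t; field; rewrite !gt_eqF.
  have h (x y z f : R) : x * (y * z) / f = y * (x * z / f) by ring.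
  by rewrite exprMn h.
rewrite ler_pM2r// (_ : expR T = expR (T / n%:R) ^+ n).
  rewrite lerXn2r ?nnegrE ?expR_ge0// ?expR_ge1Dx//.
  by rewrite addr_ge0// divr_ge0 ?ltW.
by rewrite -expRM_natl mulrC divfK ?gt_eqF.
Qed.

End coefficients.

(** * Partial sums of the complex exponential *)

Local Open Scope complex_scope.

Section exponential.
Variable R : realType.

Definition exp_sum (F : numFieldType) (n : nat) (z : F) : F := \sum_(l < n) z ^+ l / l`!%:R.

(** The part of the product of two partial sums that lies beyond the partial sum
    of the exponential of the sum. *)
Definition exp_cross (F : numFieldType) (n : nat) (z w : F) : F :=
  \sum_(i < n) \sum_(j < n | (n <= i + j)%N) (z ^+ i / i`!%:R) * (w ^+ j / j`!%:R).

Lemma exp_sumM (F : numFieldType) n (z w : F) :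
  exp_sum n z * exp_sum n w = exp_sum n (z + w) + exp_cross n z w.
Proof.
pose f i j : F := (z ^+ i / i`!%:R) * (w ^+ j / j`!%:R).
have fn m : m`!%:R != 0 :> F by rewrite pnatr_eq0 -lt0n fact_gt0.
transitivity (\sum_(i < n) \sum_(j < n) f i j).
  by rewrite /exp_sum mulr_suml; apply: eq_bigr => i _; rewrite mulr_sumr.
rewrite (eq_bigr (fun i : 'I_n => \sum_(j < n | (i + j < n)%N) f i j +
    \sum_(j < n | (n <= i + j)%N) f i j)) => [|i _]; last first.
  rewrite (bigID (fun j : 'I_n => (i + j < n)%N))/=; congr (_ + _).
  by apply: eq_bigl => j; rewrite -leqNgt.
rewrite big_split/=; congr (_ + _).
transitivity (\sum_(l < n) \sum_(i < n | (i <= l)%N) f i (l - i)%N); last first.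
  apply: eq_bigr => l _; rewrite (addrC z) exprDn mulr_suml.
  rewrite -(big_ord_widen n (fun i => f i (l - i)%N) (ltn_ord l)).
  apply: eq_bigr => i _; have il : (i <= l)%N by rewrite -ltnS.
  rewrite /f -mulr_natr.
  have -> : l`!%:R = 'C(l, i)%:R * (i`!%:R * (l - i)`!%:R) :> F by rewrite -!natrM bin_fact.
  have b0 : 'C(l, i)%:R != 0 :> F by rewrite pnatr_eq0 -lt0n bin_gt0.
  by field; rewrite b0 !fn.
rewrite [RHS](exchange_big_dep xpredT)//=; apply: eq_bigr => i _.
rewrite -(big_mkord (fun l => (i <= l)%N) (fun l => f i (l - i)%N)).
rewrite -(big_nat_widenl _ _ _ xpredT)// -[in RHS](add0n (i : nat)) big_addn big_mkord.
rewrite (eq_bigl (fun j : 'I_n => (j < n - i)%N)); last by move=> j; rewrite ltn_subRL.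
rewrite -(big_ord_widen n (f i) (leq_subr _ _)).
by apply: eq_bigr => j _; rewrite add0n addnK.
Qed.

Lemma exp_cross_norm (F : numFieldType) n (z w : F) :
  `|exp_cross n z w| <= exp_cross n `|z| `|w|.
Proof.
rewrite /exp_cross; apply: le_trans (ler_norm_sum _ _ _) _; apply: ler_sum => i _.
apply: le_trans (ler_norm_sum _ _ _) _; apply: ler_sum => j _.
by rewrite !normrM !normrX !normfV !normr_nat.
Qed.

Lemma cvg_exp_sum (r : R) : exp_sum n r @[n --> \oo] --> expR r.
Proof.
rewrite (_ : (fun n => exp_sum n r) = series (exp_coeff r)).
  exact: is_cvg_series_exp_coeff.
by apply/funext => n; rewrite /series/= big_mkord.
Qed.

(** The topology of the complex numbers is given by a complex-valued modulus;
    this reduces convergence to real sequences. *)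
Lemma cvg_complex_dominated (u : nat -> R[i]^o) (l : R[i]^o) (e : nat -> R) :
  (\forall n \near \oo, `|u n - l| <= (e n)%:C) -> e n @[n --> \oo] --> 0 ->
  u n @[n --> \oo] --> l.
Proof.
move=> ue e0; apply/cvgrPdist_lt => eps eps0.
have epsE : eps = (complex.Re eps)%:C by apply/esym/RRe_real; exact: gtr0_real.
have re0 : 0 < complex.Re eps by move: eps0; rewrite {1}epsE ltcR.
near=> n; rewrite distrC; apply: (@le_lt_trans _ _ (e n)%:C); first by near: n.
rewrite epsE ltcR; near: n.
by have /cvgr_lt/(_ _ re0) := e0.
Unshelve. all: by end_near. Qed.

Lemma complex_norm_real (x : R) : `|x%:C| = `|x|%:C.
Proof. by rewrite normc_def/= (expr0n _ 2) addr0 sqrtr_sqr. Qed.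

Lemma complex_norm_i : `|'i%C : R[i]| = 1.
Proof. by rewrite normc_def/= (expr0n _ 2) add0r expr1n sqrtr1. Qed.

Lemma cvg_complex_pair (a b : nat -> R) (x y : R) :
  a n @[n --> \oo] --> x -> b n @[n --> \oo] --> y ->
  ((a n +i* b n) : R[i]^o) @[n --> \oo] --> (x +i* y : R[i]^o).
Proof.
move=> ax bY; apply: (@cvg_complex_dominated _ _ (fun n => `|a n - x| + `|b n - y|)).
  near=> n; rewrite (_ : _ - _ = (a n - x)%:C + 'i%C * (b n - y)%:C); last first.
    by apply/eqP; rewrite eq_complex/=; apply/andP; split; apply/eqP; ring.
  apply: le_trans (ler_normD _ _) _.
  by rewrite normrM complex_norm_i mul1r !complex_norm_real -rmorphD.
have h (c : nat -> R) z : c n @[n --> \oo] --> z -> `|c n - z| @[n --> \oo] --> (0 : R).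
  move=> cz; rewrite -[X in _ --> X](normr0 R) -(subrr z).
  by apply: cvg_norm; apply: cvgB => //; exact: cvg_cst.
by have := cvgD (h _ _ ax) (h _ _ bY); rewrite addr0; exact.
Unshelve. all: by end_near. Qed.

Lemma exp_sum_real n (r : R) : exp_sum n r%:C = (exp_sum n r)%:C.
Proof.
by rewrite /exp_sum rmorph_sum; apply: eq_bigr => l _; rewrite rmorphM rmorphXn fmorphV rmorph_nat.
Qed.

Lemma complex_pairE (x y : R) : x +i* y = x%:C + 'i%C * y%:C.
Proof. by apply/eqP; rewrite eq_complex/=; apply/andP; split; apply/eqP; ring. Qed.

(** The powers of i separate the terms of the cosine series from those of the
    sine series. *)
Lemma exp_sum_imaginary n (y : R) :
  exp_sum n ('i%C * y%:C) = series (cos_coeff y) n +i* series (sin_coeff y) n.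
Proof.
rewrite /series/= !big_mkord [RHS]complex_pairE !rmorph_sum mulr_sumr -big_split/=.
apply: eq_bigr => l _; rewrite /cos_coeff /sin_coeff/=.
rewrite exprMn -!rmorphXn/= -{1}(odd_double_half l) exprD -mul2n exprM sqr_i.
rewrite !rmorphM !fmorphV !rmorph_nat !rmorphXn/= !rmorphN !rmorph1.
have half : odd l -> l.-1./2 = l./2.
  by case: (nat_of_ord l) => //= k; rewrite uphalf_half => /negbTE ->.
case: (odd l) half => /= [->//|_]; last by rewrite expr0 !mul0r mulr0 addr0.
by rewrite expr1 !mul0r add0r !mul1r !mulrA.
Qed.

(** The functional equation reduces to real and purely imaginary arguments. Its
    defect [exp_cross] at z, w is bounded by the defect at |z|, |w|, which tends
    to 0 because the real exponential satisfies the functional equation. *)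
Lemma cvg_exp_sum_complex (z : R[i]) :
  (exp_sum n z : R[i]^o) @[n --> \oo] --> (complex_exp z : R[i]^o).
Proof.
case: z => x y.
pose w := 'i%C * y%:C; have zE : x +i* y = x%:C + w := complex_pairE x y.
have cx : exp_sum n x @[n --> \oo] --> expR x by exact: cvg_exp_sum.
have cc : series (cos_coeff y) n @[n --> \oo] --> cos y.
  by rewrite cos.unlock; exact: is_cvg_series_cos_coeff.
have cs : series (sin_coeff y) n @[n --> \oo] --> sin y.
  by rewrite sin.unlock; exact: is_cvg_series_sin_coeff.
have prod : (exp_sum n x%:C * exp_sum n w : R[i]^o) @[n --> \oo] -->
    (expR x * cos y +i* (expR x * sin y) : R[i]^o).
  rewrite (_ : (fun n => _) = fun n => (exp_sum n x * series (cos_coeff y) n) +i*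
      (exp_sum n x * series (sin_coeff y) n)).
    by apply: cvg_complex_pair; exact: cvgM.
  apply/funext => n; rewrite exp_sum_imaginary exp_sum_real.
  by apply/eqP; rewrite eq_complex/=; apply/andP; split; apply/eqP; ring.
have cross0 : exp_cross n `|x| `|y| @[n --> \oo] --> (0 : R).
  rewrite (_ : (fun n => _) = fun n => exp_sum n `|x| * exp_sum n `|y| - exp_sum n (`|x| + `|y|)).
    rewrite -[X in _ --> X](subrr (expR (`|x| + `|y|))) {1}expRD.
    by apply: cvgB; [apply: cvgM|]; exact: cvg_exp_sum.
  by apply/funext => n; rewrite exp_sumM addrC addrA addNr add0r.
have cr : (exp_cross n x%:C w : R[i]^o) @[n --> \oo] --> (0 : R[i]^o).
  apply: cvg_complex_dominated cross0; near=> n.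
  rewrite subr0; apply: le_trans (exp_cross_norm _ _ _) _.
  rewrite normrM complex_norm_i mul1r !complex_norm_real le_eqVlt; apply/orP; left; apply/eqP.
  rewrite /exp_cross rmorph_sum; apply: eq_bigr => i _; rewrite rmorph_sum.
  by apply: eq_bigr => j _; rewrite !rmorphM !rmorphXn !fmorphV !rmorph_nat.
rewrite (_ : (fun n => _) = fun n => exp_sum n x%:C * exp_sum n w - exp_cross n x%:C w).
  have H := cvgB prod cr. rewrite subr0 in H. exact: H.
by apply/funext => n; rewrite exp_sumM addrK zE.
Unshelve. all: by end_near. Qed.

End exponential.

(** * The sandwich *)

Section sandwich.
Variable R : realType.

(** The ratio is the product of the 1 - i / n for i < j, and the sum of the i /
    n is j (j - 1) / (2 n). *)
Lemma ffact_ratio_bounds n j : (0 < n)%N -> (j <= n)%N ->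
  1 - (j * j.-1)%:R / (2 * n%:R) <= (n ^_ j)%:R / n%:R ^+ j :> R /\
  (n ^_ j)%:R / n%:R ^+ j <= 1 :> R.
Proof.
move=> n0; have nR : 0 < n%:R :> R by rewrite ltr0n.
elim: j => [|j IH] jn; first by rewrite mul0n mul0r subr0 expr0 divr1 ffactn0; split; exact: lexx.
have [lo hi] := IH (ltnW jn).
have E : (n ^_ j.+1)%:R / n%:R ^+ j.+1 =
    (n ^_ j)%:R / n%:R ^+ j * (1 - j%:R / n%:R) :> R.
  rewrite ffactnSr natrM natrB ?(ltnW jn)// exprSr; field.
  by rewrite expf_neq0 gt_eqF.
have q0 : 0 <= j%:R / n%:R :> R by rewrite divr_ge0.
have q1 : j%:R / n%:R <= 1 :> R by rewrite ler_pdivrMr// mul1r ler_nat ltnW.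
rewrite E; set a := (n ^_ j)%:R / n%:R ^+ j in lo hi *.
have a0 : 0 <= a by rewrite divr_ge0// exprn_ge0.
split; last by rewrite mulr_ile1 ?subr_ge0// gerBl.
have -> : (j.+1 * j.+1.-1)%:R / (2 * n%:R) =
    (j * j.-1)%:R / (2 * n%:R) + j%:R / n%:R :> R.
  have -> : (j.+1 * j.+1.-1)%:R = (j * j.-1)%:R + 2 * j%:R :> R.
    rewrite -natrM -natrD; congr (_%:R).
    case: j {IH jn lo hi E q0 q1 a a0} => //= j.
    by rewrite (mulnC j.+1 j) -mulnDl addn2.
  by field; rewrite gt_eqF.
by rewrite mulrBr mulr1 opprD addrA lerB// ler_piMl.
Qed.

(** Common lower bound of the j-th coefficients of the renormalized polynomial
    and of the exponential series. *)
Definition ffact_coef n j : R := ((n ^_ j)%:R / n%:R ^+ j) ^+ 2 / j`!%:R.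

Lemma ffact_coef_bounds n j : (0 < n)%N -> (j <= n)%N ->
  (1 - (j * j.-1)%:R / n%:R) / j`!%:R <= ffact_coef n j <= j`!%:R^-1.
Proof.
move=> n0 jn; have [lo hi] := ffact_ratio_bounds n0 jn.
have nR : 0 < n%:R :> R by rewrite ltr0n.
have f0 : 0 < j`!%:R^-1 :> R by rewrite invr_gt0 ltr0n fact_gt0.
rewrite /ffact_coef; set a := (n ^_ j)%:R / n%:R ^+ j in lo hi *.
have a0 : 0 <= a by rewrite divr_ge0// exprn_ge0.
apply/andP; split; last by rewrite -[leRHS]mul1r ler_pM2r// exprn_ile1.
rewrite ler_pM2r//.
have E : (j * j.-1)%:R / n%:R = 2 * ((j * j.-1)%:R / (2 * n%:R)) :> R.
  by field; rewrite gt_eqF.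
rewrite E; have := sqr_ge0 (1 - a); rewrite sqrrB; lra.
Qed.

Lemma exp_sum_le_expR n (r : R) : 0 <= r -> exp_sum n r <= expR r.
Proof.
move=> r0; have H := @cvg_exp_sum R r; apply: (cvgr_to_ge H).
exists n => // m /= nm; rewrite /exp_sum -(subnKC nm) big_split_ord/= lerDl.
by apply: sumr_ge0 => i _; rewrite divr_ge0// exprn_ge0.
Qed.

(** The coefficientwise gap is at most j (j - 1) / n times the exponential
    coefficient, and j (j - 1) r^j / j! is r^2 times an exponential term of
    index j - 2. *)
Lemma exp_sum_sub_ffact n (r : R) : (0 < n)%N -> 0 <= r ->
  exp_sum n.+1 r - \sum_(j < n.+1) ffact_coef n j * r ^+ j <= r ^+ 2 * expR r / n%:R.
Proof.
move=> n0 r0; have nR : 0 < n%:R :> R by rewrite ltr0n.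
rewrite /exp_sum -sumrB.
apply: (@le_trans _ _ (\sum_(j < n.+1) (j * j.-1)%:R / n%:R * (r ^+ j / j`!%:R))).
  apply: ler_sum => j _; have /andP[lo _] := ffact_coef_bounds n0 (ltn_ord j).
  rewrite (mulrC (ffact_coef _ _)) -mulrBr mulrCA ler_wpM2l ?exprn_ge0//.
  by move: lo; lra.
case: n n0 nR => // n _ nR.
rewrite 2!big_ord_recl /= mul0n muln0 !mul0r !add0r.
apply: (@le_trans _ _ (r ^+ 2 / n.+1%:R * exp_sum n r)); last first.
  rewrite mulrAC; apply: ler_wpM2r; first by rewrite invr_ge0.
  by apply: ler_wpM2l; [exact: exprn_ge0|exact: exp_sum_le_expR].
rewrite le_eqVlt; apply/orP; left; apply/eqP.
rewrite /exp_sum mulr_sumr; apply: eq_bigr => i _.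
rewrite /bump/= !add1n !factS !natrM !exprS /=.
have fi : i`!%:R != 0 :> R by rewrite pnatr_eq0 -lt0n fact_gt0.
by field; rewrite fi !nat1r -(natrD _ 2) !pnatr_eq0.
Qed.

Lemma complex_norm_re (z : R[i]) : `|z| = (complex.Re `|z|)%:C.
Proof. by apply/esym/RRe_real; exact: normr_real. Qed.

(** The coefficients m i and those of the exponential series both exceed
    [ffact_coef]. At r = |z| the total excess is controlled for both, and the
    modulus of the difference at z is at most the sum of the two totals. *)
Lemma sandwich_exp_sum n (m : nat -> R) (z : R[i]) (r := complex.Re `|z|) :
  (0 < n)%N -> (forall i, (i < n)%N -> ffact_coef n i.+1 <= m i) ->
  1 + \sum_(i < n) m i * r ^+ i.+1 <= expR r ->
  `|1 + \sum_(i < n) (m i)%:C * z ^+ i.+1 - exp_sum n.+1 z| <=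
    (expR r - exp_sum n.+1 r + 2 * (r ^+ 2 * expR r / n%:R))%:C.
Proof.
move=> n0 lm mr; have zr : `|z| = r%:C := complex_norm_re z.
have r0 : 0 <= r by rewrite -lecR -zr rmorph0 normr_ge0.
have expS (F : numFieldType) (w : F) :
    exp_sum n.+1 w = 1 + \sum_(i < n) w ^+ i.+1 / (i.+1)`!%:R.
  by rewrite /exp_sum big_ord_recl expr0 divr1.
have -> : 1 + \sum_(i < n) (m i)%:C * z ^+ i.+1 - exp_sum n.+1 z =
    \sum_(i < n) (m i - (i.+1)`!%:R^-1)%:C * z ^+ i.+1.
  rewrite expS opprD addrACA subrr add0r -sumrB; apply: eq_bigr => i _.
  by rewrite rmorphB fmorphV rmorph_nat mulrBl (mulrC (z ^+ _)).
apply: le_trans (ler_norm_sum _ _ _) _.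
rewrite (eq_bigr (fun i : 'I_n => (`|m i - (i.+1)`!%:R^-1| * r ^+ i.+1)%:C)) => [|i _]; last first.
  by rewrite normrM normrX zr complex_norm_real rmorphM rmorphXn.
rewrite -rmorph_sum lecR/=.
have H := exp_sum_sub_ffact n0 r0.
pose L := \sum_(i < n) ffact_coef n i.+1 * r ^+ i.+1.
have LE : \sum_(j < n.+1) ffact_coef n j * r ^+ j = 1 + L.
  rewrite big_ord_recl expr0 /ffact_coef ffactn0 expr0 !divr1 expr1n mulr1.
  by congr (_ + _); apply: eq_bigr => i _; rewrite /bump/= add1n.
rewrite LE in H.
(* Both m i and 1 / (i + 1)! lie above the lower bound, so their distance is
   at most the sum of the two gaps. *)
have : \sum_(i < n) `|m i - (i.+1)`!%:R^-1| * r ^+ i.+1 <=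
    (\sum_(i < n) m i * r ^+ i.+1 - L) + (\sum_(i < n) r ^+ i.+1 / (i.+1)`!%:R - L).
  rewrite /L -!sumrB -big_split/=; apply: ler_sum => i _.
  have /andP[_ hi] := ffact_coef_bounds n0 (ltn_ord i).
  have lo := lm i (ltn_ord i).
  rewrite (mulrC _ (_^-1)) -!mulrBl -mulrDl ler_wpM2r ?exprn_ge0//.
  by rewrite ler_norml; apply/andP; split; lra.
by move: H mr; rewrite expS; lra.
Qed.

Lemma cvg_sandwich_error (r : R) :
  expR r - exp_sum n.+1 r + 2 * (r ^+ 2 * expR r / n%:R) @[n --> \oo] --> (0 : R).
Proof.
have h : (exp_sum n.+1 r) @[n --> \oo] --> expR r.
  by have := @cvg_exp_sum R r; rewrite -cvg_shiftS.
have hn : (n%:R^-1 : R) @[n --> \oo] --> (0 : R).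
  by rewrite -cvg_shiftS; exact: cvg_harmonic.
have -> : (0 : R) = (expR r - expR r) + 2 * (r ^+ 2 * expR r * 0) by rewrite subrr !mulr0 addr0.
apply: cvgD; first by apply: cvgB => //; exact: cvg_cst.
apply: cvgM; first exact: cvg_cst.
by apply: cvgM => //; exact: cvg_cst.
Qed.

End sandwich.

(** * The Gamma function at positive integers *)

Section gamma.
Variable R : realType.
Local Notation leb := (@lebesgue_measure R).

(** The exponential dominates x^(i + 1) / (i + 1)!. *)
Lemma cvg_exprn_expRN (i : nat) : x ^+ i * expR (- x) @[x --> +oo] --> (0 : R).
Proof.
have vx : (i.+1)`!%:R * x^-1 @[x --> +oo] --> (0 : R).
  rewrite -[X in _ --> X](mulr0 (i.+1)`!%:R); apply: cvgM; first exact: cvg_cst.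
  apply/(gtr0_cvgV0 (f := id)); last exact: cvg_id.
  exact: nbhs_pinfty_gt.
apply: (squeeze_cvgr _ (cvg_cst 0) vx); near=> x.
have x0 : 0 < x by near: x; exact: nbhs_pinfty_gt.
rewrite mulr_ge0 ?exprn_ge0 ?expR_ge0 ?(ltW x0)//=.
rewrite expRN ler_pdivlMr// mulrAC ler_pdivrMr ?expR_gt0//.
have f0 : 0 < (i.+1)`!%:R :> R by rewrite ltr0n fact_gt0.
have := expR_ge1Dxn i (ltW x0); rewrite -exprSr => H.
by rewrite -ler_pdivrMl// mulrC; lra.
Unshelve. all: by end_near. Qed.

Lemma cvg_poly_expRN (p : {poly R}) : p.[x] * expR (- x) @[x --> +oo] --> (0 : R).
Proof.
rewrite (_ : (fun x => _) = fun x => \sum_(i < size p) p`_i * (x ^+ i * expR (- x))).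
  elim: (size p) => [|n IH]; first by under eq_fun do rewrite big_ord0; exact: cvg_cst.
  under eq_fun do rewrite big_ord_recr/=.
  have := cvgD IH (cvgM (cvg_cst p`_n) (@cvg_exprn_expRN n)).
  by rewrite mulr0 addr0; exact.
apply/funext => x; rewrite horner_coef mulr_suml.
by apply: eq_bigr => i _; rewrite mulrA.
Qed.

(** The polynomial p with p - p' = X^l, so that - p(x) exp(-x) is a primitive of
    x^l exp(-x). *)
Definition gamma_poly (l : nat) : {poly R} := \sum_(i < l.+1) (l`!%:R / i`!%:R) *: 'X^i.

Lemma gamma_polyE l : gamma_poly l - (gamma_poly l)^`() = 'X^l.
Proof.
have fn m : m`!%:R != 0 :> R by rewrite pnatr_eq0 -lt0n fact_gt0.
rewrite /gamma_poly {1}big_ord_recr/= divff// scale1r linear_sum/= big_ord_recl/=.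
rewrite derivZ derivXn mulr0n scaler0 add0r addrAC -[RHS]add0r; congr (_ + _).
rewrite -sumrB big1// => i _; rewrite /bump/= add1n derivZ derivXn/= -scalerMnr scalerMnl.
have -> : l`!%:R / (i.+1)`!%:R *+ i.+1 = l`!%:R / i`!%:R :> R; last by rewrite subrr.
rewrite factS natrM -mulr_natr; field; rewrite fn nat1r pnatr_eq0.
by [].
Qed.

Lemma Gamma_nat l : Gamma (l%:R + 1 : R) = l`!%:R.
Proof.
rewrite /Gamma addrK.
have cexpN : continuous (fun x : R => expR (- x)).
  by move=> x; apply: continuous_comp; [exact: opp_continuous|exact: continuous_expR].
have cf : continuous (fun x : R => x ^+ l * expR (- x)).
  by move=> x; apply: cvgM; [exact: exprn_continuous|exact: cexpN].
transitivity (\int[leb]_(x in `[0, +oo[) (x ^+ l * expR (- x))).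
  rewrite /Rintegral -integral_itv_obnd_cbnd; last first.
    by apply: measurable_funTS; apply/measurable_EFinP; exact: continuous_measurable_fun.
  congr fine; apply: eq_integral => x; rewrite mem_setE in_itv/= => /andP[x0 _].
  by rewrite powR_mulrn// ltW.
pose F (x : R) := - ((gamma_poly l).[x] * expR (- x)).
have dF (x : R) : is_derive x 1 F (x ^+ l * expR (- x)).
  rewrite /F; apply: is_derive_eq.
  rewrite -(hornerXn x) -gamma_polyE hornerD hornerN /GRing.scale/=.
  ring.
rewrite (@Rintegral_ge0_continuous_FTC2y _ _ F 0 0).
- rewrite /F oppr0 expR0 mulr1 sub0r opprK /gamma_poly horner_sum big_ord_recl/=.
  rewrite hornerZ hornerXn expr0 fact0 divr1 mulr1 big1 ?addr0// => i _.
  by rewrite hornerZ hornerXn expr0n/= mulr0.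
- by move=> x x0; rewrite mulr_ge0 ?exprn_ge0 ?expR_ge0.
- by apply: continuous_subspaceT.
- by rewrite -oppr0; apply: cvgN; exact: cvg_poly_expRN.
- by move=> x _; have [] := dF x.
- apply: cvg_at_right_filter; apply: differentiable_continuous.
  by apply/derivable1_diffP; have [] := dF 0.
- by move=> x _; rewrite derive1E; have [_ ->] := dF x.
Qed.
End gamma.

(** * Conclusion *)

Theorem mainTheorem6 (R : realType) (rho : R) (hrho : 0 < rho) (tau : R[i]) :
  ((fun n : nat =>
      complex_eval (renormalized_steiner_poly (cross_polytope rho n)) tau)
     @ \oo --> (complex_exp tau : R[i]^o))
  /\
  (series (fun l : nat => (((Gamma (l%:R + 1 : R))^-1)%:C * tau ^+ l : R[i]^o))
     @ \oo --> (complex_exp tau : R[i]^o)).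
Proof.
have cvgE := @cvg_exp_sum_complex R tau.
split; last first.
  rewrite (_ : series _ = fun n => exp_sum n tau)//; apply/funext => n.
  rewrite /series/= big_mkord; apply: eq_bigr => l _.
  by rewrite Gamma_nat fmorphV rmorph_nat mulrC.
pose u n : R[i]^o :=
  complex_eval (renormalized_steiner_poly (cross_polytope rho n)) tau - exp_sum n.+1 tau.
have u0 : u n @[n --> \oo] --> (0 : R[i]^o).
  apply: cvg_complex_dominated (cvg_sandwich_error (complex.Re `|tau|)).
  exists 1%N => // n /= n0; rewrite subr0 /u.
  rewrite /complex_eval renormalized_cross_polytope// rmorphD rmorph1 hornerD hornerC.
  rewrite rmorph_sum horner_sum.
  rewrite (eq_bigr (fun i : 'I_n => (renormalized_coef n rho i)%:C * tau ^+ i.+1)).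
    apply: sandwich_exp_sum => //.
    - by move=> i ilt; exact: renormalized_coef_ge.
    - apply: renormalized_le_expR => //.
      by rewrite -lecR -complex_norm_re rmorph0 normr_ge0.
  by move=> i _; rewrite /= map_polyZ map_polyXn hornerZ hornerXn.
have cvgE1 : (exp_sum n.+1 tau : R[i]^o) @[n --> \oo] --> (complex_exp tau : R[i]^o).
  by move: cvgE; rewrite -cvg_shiftS.
have H := cvgD u0 cvgE1; rewrite add0r in H.
rewrite (_ : (fun n => _) = fun n => u n + exp_sum n.+1 tau); first exact: H.
by apply/funext => n; rewrite /u subrK.
Qed.
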